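(* Let $S\subset\mathbb{R}^3$ be a conical surface, not a plane, with a smooth cross-section of length $\ell\le2\pi$. Then $$k_S\ \ge\ \frac{\sqrt{4\pi^2-\ell^2}}{4\pi\ell},$$ and the equality holds if and only if $S$ is a circular cone.
   Context: A conical surface in $\mathbb{R}^3$ is a Lipschitz hypersurface $S\subset\mathbb{R}^3$ with $\lambda S=S$ for all $\lambda>0$. Its cross-section is $\gamma:=S\cap\mathbb{S}^2$, where $\mathbb{S}^2$ is the unit sphere of $\mathbb{R}^3$ centered at the origin. $S$ is said to have a smooth cross-section if $\gamma$ is a $C^4$ smooth (simple closed) loop. $S$ is a plane if and only if $\gamma$ is a great circle. $S$ is a circular cone (of opening angle $2\theta$, $\theta\in(0,\frac\pi2)$) if $\gamma$ is a circle on $\mathbb{S}^2$ of geodesic radius $\theta$. Let $\ell>0$ be the length of $\gamma$ and $\mathbb{T}=\mathbb{R}/\ell\mathbb{Z}$. Let $\Gamma:\mathbb{T}\to\mathbb{R}^3$ be an arc-length parametrization of $\gamma$, i.e. an injective $C^4$ function with $\Gamma(\mathbb{T})=\gamma$ and $|\Gamma'|\equiv1$. Set $n:=\Gamma\times\Gamma'$. The geodesic curvature $\kappa$ of $\gamma$ is defined by $n'(s)=\kappa(s)\Gamma'(s)$, i.e. $\kappa=(\Gamma\times\Gamma'')\cdot\Gamma'$. The assumption that $S$ is not a plane is equivalent to $\kappa\not\equiv0$. Let $\mathcal{K}_S=-\frac{d^2}{ds^2}-\frac{\kappa^2}{4}$ be the self-adjoint operator in $L^2(\mathbb{T})$ with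 domain $H^2(\mathbb{T})$. It has compact resolvent; its eigenvalues, in non-decreasing order and counted with multiplicities, are $\lambda_j(\mathcal{K}_S)$, $j\in\mathbb{N}=\{1,2,\dots\}$. Set $$k_S:=\frac1{2\pi}\sum_{j\in\mathbb{N}:\ \lambda_j(\mathcal{K}_S)<0}\sqrt{-\lambda_j(\mathcal{K}_S)} .$$ *)

(* Defs.v *)
From HB Require Import structures.
From mathcomp Require Import all_boot all_order all_algebra.
From mathcomp Require Import all_classical all_reals all_analysis.
From mathcomp Require Import complex.
Set Implicit Arguments.
Unset Strict Implicit.
Unset Printing Implicit Defensive.
Import Order.TTheory GRing.Theory Num.Theory.
Import numFieldNormedType.Exports.
Local Open Scope complex_scope.
Local Open Scope ring_scope.
Local Open Scope classical_set_scope.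

Definition dot (R : realType) (u v : 'rV[R]_3) : R := \sum_i u 0 i * v 0 i.

(* The indices k + 1 and k + 2 are computed modulo 3. *)
Definition cross (R : realType) (u v : 'rV[R]_3) : 'rV[R]_3 :=
  \row_(k < 3) (u 0 (k + 1) * v 0 (k + 2) - u 0 (k + 2) * v 0 (k + 1)).

(* The norm `|u| of the normed module 'rV[R]_3 is the sup norm. *)
Definition enorm (R : realType) (u : 'rV[R]_3) : R := Num.sqrt (dot u u).

Definition sphere (R : realType) : set 'rV[R]_3 := [set x | enorm x = 1].

(* Two-dimensional Lipschitz submanifold of R^3: near each of its points, S is
   mapped into the plane {x_2 = 0} by a bi-Lipschitz chart of the ambient space.
   A local graph x_2 = f(x_0, x_1) of a Lipschitz function f, in suitable
   orthonormal coordinates, has the chart (x_0, x_1, x_2 - f(x_0, x_1)).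
   The Lipschitz property does not depend on the norm. *)
Definition lipschitz_hypersurface (R : realType) (S : set 'rV[R]_3) : Prop :=
  forall p, S p ->
  exists (U : set 'rV[R]_3) (phi psi : 'rV[R]_3 -> 'rV[R]_3) (L : R),
    [/\ open U, U p & open (phi @` U)] /\
    [/\ {in U, cancel phi psi},
        L.-lipschitz_U phi,
        L.-lipschitz_(phi @` U) psi &
        phi @` (S `&` U) = (phi @` U) `&` [set y : 'rV[R]_3 | y 0 2 = 0]].

Definition conical_surface (R : realType) (S : set 'rV[R]_3) : Prop :=
  lipschitz_hypersurface S /\
  forall t : R, 0 < t -> [set t *: x | x in S] = S.

Definition cross_section (R : realType) (S : set 'rV[R]_3) : set 'rV[R]_3 :=
  S `&` @sphere R.

(* The vertex 0 is added because a conical surface need not contain it. *)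
Definition is_plane (R : realType) (S : set 'rV[R]_3) : Prop :=
  exists v : 'rV[R]_3, v != 0 /\ S `|` [set 0] = [set x | dot v x = 0].

(* acos (dot v x) is the geodesic distance of the points v, x of the sphere. *)
Definition circular_cone (R : realType) (S : set 'rV[R]_3) : Prop :=
  exists (v : 'rV[R]_3) (theta : R),
    [/\ sphere v, 0 < theta < pi / 2 &
        cross_section S = [set x | sphere x /\ acos (dot v x) = theta]].

Definition C4 (R : realType) (f : R -> 'rV[R]_3) : Prop :=
  (forall k : nat, (k < 4)%N -> forall s : R, derivable (derive1n k f) s 1) /\
  continuous (derive1n 4 f).

(* Functions on T = R / ell Z are ell-periodic functions on R; gamma is then a
   C^4 simple closed loop of length ell. *)
Definition arclength_param (R : realType) (gamma : set 'rV[R]_3) (ell : R)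
    (Gamma : R -> 'rV[R]_3) : Prop :=
  [/\ 0 < ell /\ periodic Gamma ell,
      {in `[0, ell[ &, injective Gamma},
      C4 Gamma,
      range Gamma = gamma &
      forall s, enorm (derive1 Gamma s) = 1].

Definition geodesic_curvature (R : realType) (Gamma : R -> 'rV[R]_3) (s : R) : R :=
  dot (cross (Gamma s) (derive1n 2 Gamma s)) (derive1 Gamma s).

(* f is (the C^1 representative of) a real-valued element of H^2(T), and g is
   its second derivative in L^2, given on the fundamental domain [0, ell]. *)
Definition H2_deriv2 (R : realType) (ell : R) (f g : R -> R) : Prop :=
  let mu := @lebesgue_measure R in
  [/\ periodic f ell,
      forall s, derivable f s 1,
      measurable_fun `[0, ell] g,
      (\int[mu]_(s in `[0%R, ell]) ((g s) ^+ 2)%:E < +oo)%E &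
      forall t, 0 <= t <= ell -> derive1 f t = derive1 f 0 + \int[mu]_(s in `[0, t]) g s].

(* Kernel of K - mu, for K = - d^2/ds^2 - kappa^2/4 in the complex Hilbert space
   L^2(T) with domain H^2(T).  A class in H^2(T) is given by its C^1
   representative, so that distinct functions are distinct in L^2(T). *)
Definition eigenspace_K (R : realType) (ell : R) (kappa : R -> R) (mu : R) :
    set (R -> R[i]) :=
  [set f | exists g : R -> R[i],
    [/\ H2_deriv2 ell (fun s => complex.Re (f s)) (fun s => complex.Re (g s)),
        H2_deriv2 ell (fun s => complex.Im (f s)) (fun s => complex.Im (g s)) &
        {ae @lebesgue_measure R, forall s, 0 <= s <= ell ->
           - g s - (kappa s ^+ 2 / 4)%:C * f s = mu%:C * f s}]].

(* The uniqueness of the coefficients of f = 0 gives linear independence. *)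
Definition has_dim (R : realType) (V : set (R -> R[i])) (n : nat) : Prop :=
  exists e : 'I_n -> R -> R[i],
    (forall i, V (e i)) /\
    forall f, V f ->
      exists! c : {ffun 'I_n -> R[i]}, f = fun s => \sum_i c i * e i s.

(* lam j is the (j+1)-st eigenvalue of K, in non-decreasing order and counted
   with multiplicities. *)
Definition eigenvalue_sequence (R : realType) (ell : R) (kappa : R -> R)
    (lam : nat -> R) : Prop :=
  (forall i j, (i <= j)%N -> lam i <= lam j) /\
  forall mu : R, exists2 n : nat,
    has_dim (eigenspace_K ell kappa mu) n & ([set j | lam j = mu] #= `I_n)%card.

Definition k_S (R : realType) (lam : nat -> R) : \bar R :=
  (((2 * pi)^-1)%:E *
     \sum_(0 <= j <oo | (lam j < 0)%R) (Num.sqrt (- lam j))%:E)%E.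

(* Main.v *)
Require Import Defs.
From mathcomp Require Import all_boot all_order all_algebra.
From mathcomp Require Import all_classical all_reals all_analysis.
From mathcomp Require Import measurable_realfun complex ring lra.
Set Implicit Arguments.
Unset Strict Implicit.
Unset Printing Implicit Defensive.
Import Order.TTheory GRing.Theory Num.Theory.
Import numFieldNormedType.Exports.
Local Open Scope ring_scope.
Local Open Scope classical_set_scope.

(** The lower bound compares two elementary facts about a closed curve [Gamma]
    of length [ell] on the unit sphere, parametrized by arc length.

    First, [Gamma'] is [ell]-periodic with zero mean, so Wirtinger's inequality
    bounds the integral of [|Gamma''|^2] below by [(2 pi / ell)^2 * ell].  Since
    [|Gamma''|^2 = 1 + kappa^2] on the sphere, the potential [q = kappa^2 / 4]
    has a mean at least [D = ((2 pi / ell)^2 - 1) / 4] ([total_curvature_ge]).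

    Secondly, the operator [- d^2/ds^2 - q] on the circle has an eigenvalue [- m]
    with [m] at least the mean of [q], as the constants show through their
    Rayleigh quotient.  The minimization is replaced here by a shooting argument
    for Hill's equation [u'' = (m - q) u] ([hill_periodic_solution]): a periodic
    solution exists when the discriminant, the trace of the monodromy matrix,
    equals 2.  The discriminant is continuous in [m] and at least 2 above the
    potential; it is at most 2 somewhere above the mean of [q], by a Riccati
    substitution if the solution vanishing at 0 has no other zero on the period,
    and otherwise at the last [m] for which the Dirichlet problem on a period has
    an eigenfunction.  The
    intermediate value theorem concludes.

    The eigenvalue [- m] alone contributes [sqrt m / (2 pi)], and
    [sqrt D / (2 pi)] is the bound.  Equality in the theorem thus forces [m = D],
    hence equality in Wirtinger's inequality.  Then [Gamma'''] is a multiple of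
    [Gamma'] ([wirtinger_eq], by the Euler-Lagrange equation), so that [Gamma]
    runs on a circle ([curve_is_circle]): a great circle if its plane contains
    the origin, which is the excluded plane, and otherwise the cross-section of
    a circular cone.

    Conversely a circle of radius [r] at height [h] has [ell = 2 pi r] and
    [kappa^2 = (h / r)^2] ([latitude_curve]).  For this constant potential,
    Wirtinger's inequality leaves [- (h / r)^2 / 4], with the constants as its
    eigenspace, as the only negative eigenvalue ([negative_eigenvalues_const]).

    Integrals over a period are written as increments of primitives, and
    functions on the circle as periodic functions on the line. *)

(** * Derivatives and primitives on the real line *)

Section rules.
Context {R : realType}.
Implicit Types (f g : R -> R) (x a b : R).

Lemma is_deriveDf f g x a b : is_derive x 1 f a -> is_derive x 1 g b ->
  is_derive x 1 (fun t => f t + g t) (a + b).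
Proof. exact: is_deriveD. Qed.

Lemma is_deriveNf f x a : is_derive x 1 f a -> is_derive x 1 (fun t => - f t) (- a).
Proof. exact: is_deriveN. Qed.

Lemma is_deriveMf f g x a b : is_derive x 1 f a -> is_derive x 1 g b ->
  is_derive x 1 (fun t => f t * g t) (f x * b + g x * a).
Proof. exact: is_deriveM. Qed.

Lemma is_deriveXf f x a n : is_derive x 1 f a ->
  is_derive x 1 (fun t => f t ^+ n.+1) (n.+1%:R * f x ^+ n * a).
Proof.
move=> fa; rewrite (_ : (fun t => _) = (f : R -> R) ^+ n.+1).
  by apply: is_derive_eq.
by apply/funext => t; rewrite exprfctE.
Qed.

Lemma is_deriveVf f x a : f x != 0 -> is_derive x 1 f a ->
  is_derive x 1 (fun t => (f t)^-1) (- (f x ^- 2 * a)).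
Proof.
move=> f0 fa; have := is_deriveV f0 fa.
by move=> h; apply: is_derive_eq; rewrite -mulNr.
Qed.

Lemma is_derive_comp f g x a b : is_derive (g x) 1 f a -> is_derive x 1 g b ->
  is_derive x 1 (fun t => f (g t)) (a * b).
Proof. by move=> fa gb; exact: (@is_derive1_comp R f g x a b). Qed.

Lemma is_derive_continuous f x a : is_derive x 1 f a -> {for x, continuous f}.
Proof. by move=> [fx _]; exact/differentiable_continuous/derivable1_diffP. Qed.
End rules.

(** Derivatives on the whole line only: an identity between derivatives then
    needs no boundary case. *)
Definition has_deriv {R : realType} (f df : R -> R) :=
  forall x : R, is_derive x (1 : R) f (df x).

(** [der] computes the derivative of an expression built from functions with a
    [has_deriv] or [is_derive] hypothesis, and leaves the identity with the
    expected value. *)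
Ltac der_step :=
  match goal with
  | |- is_derive _ _ (fun t => _ + _) _ => eapply is_deriveDf
  | |- is_derive _ _ (fun t => - _) _ => eapply is_deriveNf
  | |- is_derive _ _ (fun t => _ * _) _ => eapply is_deriveMf
  | |- is_derive _ _ (fun t => _ ^+ _.+1) _ => eapply is_deriveXf
  | |- is_derive ?x ?v (@GRing.opp ?V) ?d =>
      change (is_derive x v (fun t => - t) d); eapply is_deriveNf
  | |- is_derive ?x ?v (@GRing.mul ?V ?c) ?d =>
      change (is_derive x v (fun t => c * t) d); eapply is_deriveMf
  | |- is_derive _ _ id _ => eapply is_derive_id
  | |- is_derive _ _ (fun t => t) _ => eapply is_derive_id
  | |- is_derive _ _ (fun t => ?c) _ => eapply is_derive_cst
  | H : has_deriv ?f _ |- is_derive _ _ ?f _ => eapply H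
  | H : is_derive ?s _ ?f _ |- is_derive ?s _ ?f _ => eapply H
  | H : has_deriv ?f _ |- is_derive _ _ (fun t => ?f _) _ =>
      eapply (@is_derive_comp _ f); [eapply H|]
  | |- is_derive _ _ (fun t => expR _) _ =>
      eapply (@is_derive_comp _ expR); [eapply is_derive_expR|]
  | |- is_derive _ _ (fun t => cos _) _ =>
      eapply (@is_derive_comp _ cos); [eapply is_derive_cos|]
  | |- is_derive _ _ (fun t => sin _) _ =>
      eapply (@is_derive_comp _ sin); [eapply is_derive_sin|]
  end.
Ltac der := eapply is_derive_eq; [solve [repeat der_step] | cbv beta].

Section mean_value.
Context {R : realType}.
Implicit Types (f g df : R -> R) (x a b : R).

Lemma is_derive_within_continuous f df a b :
  (forall x, a <= x <= b -> is_derive x (1 : R) f (df x)) ->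
  {within `[a, b], continuous f}.
Proof.
move=> fdf; apply: derivable_within_continuous => x /[!in_itv]/= xab.
by have [] := fdf _ xab.
Qed.

Lemma is_derive_MVT f df a b : a <= b ->
  (forall x, a <= x <= b -> is_derive x (1 : R) f (df x)) ->
  exists2 c, a <= c <= b & f b - f a = df c * (b - a).
Proof.
move=> ab fdf; have fd x : x \in `]a, b[%R -> is_derive x (1 : R) f (df x).
  by rewrite in_itv/= => /andP[ax xb]; apply: fdf; rewrite !ltW.
have [c] := MVT_segment ab fd (is_derive_within_continuous fdf).
by rewrite in_itv/=; exists c.
Qed.

Lemma is_derive_le f df a b : a <= b ->
  (forall x, a <= x <= b -> is_derive x (1 : R) f (df x)) ->
  (forall x, a <= x <= b -> 0 <= df x) -> f a <= f b.
Proof.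
move=> ab fdf df0; rewrite -subr_ge0.
by have [c cab ->] := is_derive_MVT ab fdf; rewrite mulr_ge0 ?df0// subr_ge0.
Qed.

Lemma has_deriv_cont f df : has_deriv f df -> continuous f.
Proof. by move=> fdf x; exact: is_derive_continuous (fdf x). Qed.

Lemma has_deriv_within f df a b : has_deriv f df -> {within `[a, b], continuous f}.
Proof. by move=> /has_deriv_cont cf; exact: continuous_subspaceT. Qed.

Lemma has_deriv_le f df a b : a <= b -> has_deriv f df ->
  (forall x, a <= x <= b -> 0 <= df x) -> f a <= f b.
Proof. by move=> ab fdf; apply: is_derive_le => // x _; exact: fdf. Qed.

Lemma is_derive0_cst f df a b : a <= b ->
  (forall x, a <= x <= b -> is_derive x (1 : R) f (df x)) ->
  (forall x, a <= x <= b -> df x = 0) -> f a = f b.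
Proof.
move=> ab fdf df0; apply/eqP; rewrite eq_sym -subr_eq0.
by have [c cab ->] := is_derive_MVT ab fdf; rewrite df0 // mul0r.
Qed.

Lemma has_deriv0_cst f df a b : has_deriv f df -> (forall x, df x = 0) -> f a = f b.
Proof.
move=> fdf df0; wlog ab : a b / a <= b.
  by move=> w; have [/w//|/ltW/w] := leP a b.
by apply: (is_derive0_cst ab) => x _; [exact: fdf | exact: df0].
Qed.

Lemma has_deriv_unique f g d a b : has_deriv f d -> has_deriv g d ->
  f b - f a = g b - g a.
Proof.
move=> fd gd; have : has_deriv (fun t => f t - g t) (cst 0).
  by move=> x; der; rewrite subrr.
by move=> /(@has_deriv0_cst _ _ a b) /(_ (fun=> erefl)); lra.
Qed.
End mean_value.

Section primitive.
Context {R : realType}.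
Notation mu := (@lebesgue_measure R).
Implicit Types (f : R -> R) (s a b : R).

Let P f a s := \int[mu]_(t in `[a, s]) f t.

Lemma cont_integrable f a b : continuous f -> mu.-integrable `[a, b] (EFin \o f).
Proof.
move=> cf; apply: continuous_compact_integrable; first exact: segment_compact.
exact: continuous_subspaceT.
Qed.

Let PD f a b s : continuous f -> a <= b -> b <= s -> P f a s = P f a b + P f b s.
Proof.
move=> cf ab bs; apply/eqP; rewrite addrC -subr_eq; apply/eqP.
rewrite /P Rintegral_itvB ?bnd_simp//; last exact: cont_integrable.
rewrite Rintegral_itv_obnd_cbnd//.
apply: integrableS (cont_integrable b s cf) => //.
by apply: subset_itvr; rewrite bnd_simp.
Qed.

Let P_deriv f a s : continuous f -> a < s -> is_derive s (1 : R) (P f a) (f s).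
Proof.
move=> cf as_; have s1 : s < s + 1 by rewrite ltrDl.
have as' : ((BLeft a : itv_bound R) < BRight s)%E by rewrite /= lte_fin.
have [d1 d2] := continuous_FTC1 s1 (cont_integrable a (s + 1) cf) as' (cf s).
by split; [exact: d1|rewrite -derive1E; exact: d2].
Qed.

(** The integral from a moving base point left of both 0 and [s], less its value
    up to 0, does not depend on the base point; locally the base point can be
    fixed. *)
Lemma primitive_exists f : continuous f -> exists2 F, has_deriv F f & F 0 = 0.
Proof.
move=> cf; pose m (s : R) := Num.min s 0 - 1.
exists (fun s => P f (m s) s - P f (m s) 0); last by rewrite subrr.
move=> s; pose a := m s - 1.
apply: (@near_eq_is_derive _ _ _ (fun t => P f a t - P f a 0)) => //.
- near=> t.
  have ts : `|s - t| < 1 by near: t; exact: cvgr_dist_lt.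
  have at_ : a <= m t.
    rewrite /a /m /Num.min; move: ts; rewrite ltr_norml => /andP[? ?].
    by case: ifP; case: ifP => *; lra.
  have [mt m0] : m t <= t /\ m t <= 0 by rewrite /m /Num.min; case: ifP => *; lra.
  by rewrite (PD cf at_ mt) (PD cf at_ m0); lra.
- have as_ : a < s by rewrite /a /m /Num.min; case: ifP => *; lra.
  by have ? := P_deriv cf as_; der; rewrite subr0.
Unshelve. all: by end_near. Qed.

Lemma Rintegral_deriv f F a b : continuous f -> has_deriv F f -> a <= b ->
  \int[mu]_(t in `[a, b]) f t = F b - F a.
Proof.
move=> cf Ff; rewrite le_eqVlt => /predU1P[->|ab].
  by rewrite set_itv1 Rintegral_set1 subrr.
rewrite /Rintegral (@continuous_FTC2 _ f F)//=.
- exact: continuous_subspaceT.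
- split; first by move=> x _; have [] := Ff x.
  + exact/cvg_at_right_filter/(has_deriv_cont Ff).
  + exact/cvg_at_left_filter/(has_deriv_cont Ff).
- by move=> x _; have [_ <-] := Ff x; rewrite derive1E.
Qed.
End primitive.

(** * Second-order linear equations: existence *)

Section comparison.
Context {R : realType}.
Implicit Types (f g k u v : R -> R) (x a b c s M : R).

(** Two applications of the mean value theorem, which treat both sides of 0 at
    once. *)
Lemma convex_ge_critical G G1 G2 s : has_deriv G G1 -> has_deriv G1 G2 ->
  G1 0 = 0 -> (forall x : R, 0 <= G2 x) -> G 0 <= G s.
Proof.
move=> dG dG1 G10 G2_ge0; rewrite -subr_ge0.
(* G1 has the sign of its argument, since it increases and vanishes at 0 *)
have step c : 0 <= G1 c * c.
  have [c0|c0] := leP 0 c.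
    have [e _] := is_derive_MVT c0 (fun x _ => dG1 x).
    by rewrite G10 !subr0 => ->; rewrite -mulrA mulr_ge0// -expr2 sqr_ge0.
  have [e _] := is_derive_MVT (ltW c0) (fun x _ => dG1 x).
  rewrite G10 !sub0r => /eqP; rewrite eqr_oppLR mulrN opprK => /eqP ->.
  by rewrite -mulrA mulr_ge0// -expr2 sqr_ge0.
have [s0|s0] := leP 0 s.
  have [c /andP[c0 cs] ->] := is_derive_MVT s0 (fun x _ => dG x).
  rewrite subr0; move: s0; rewrite le_eqVlt => /predU1P[<-|s0]; first by rewrite mulr0.
  have := step c; rewrite le_eqVlt in c0; case/predU1P: c0 => [<-|c0].
    by rewrite G10 !mul0r.
  by rewrite pmulr_lge0// => ?; rewrite mulr_ge0// ltW.
have [c /andP[sc c0] e] := is_derive_MVT (ltW s0) (fun x _ => dG x).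
rewrite -opprB e sub0r mulrN opprK.
have := step c; rewrite le_eqVlt in c0; case/predU1P: c0 => [->|c0].
  by rewrite G10 !mul0r.
by rewrite nmulr_lge0// => ?; rewrite mulr_le0// ltW.
Qed.

(** [H + F] and [H - F] are convex with critical point 0. *)
Lemma deriv2_le F F1 F2 H H1 H2 s :
  has_deriv F F1 -> has_deriv F1 F2 -> has_deriv H H1 -> has_deriv H1 H2 ->
  F 0 = 0 -> F1 0 = 0 -> H1 0 = 0 -> (forall x : R, `|F2 x| <= H2 x) ->
  `|F s| <= H s - H 0.
Proof.
move=> dF dF1 dH dH1 F0 F10 H10 F2H2.
have bnd x : - H2 x <= F2 x <= H2 x by rewrite -ler_norml.
have geD : H 0 + F 0 <= H s + F s.
  apply: (@convex_ge_critical (fun t => H t + F t) (fun t => H1 t + F1 t)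
    (fun t => H2 t + F2 t)) => [x|x||x]; [by der|by der|by rewrite H10 F10 addr0|].
  by have := bnd x; lra.
have geB : H 0 - F 0 <= H s - F s.
  apply: (@convex_ge_critical (fun t => H t - F t) (fun t => H1 t - F1 t)
    (fun t => H2 t - F2 t)) => [x|x||x]; [by der|by der|by rewrite H10 F10 subr0|].
  by have := bnd x; lra.
by rewrite ler_norml; apply/andP; split; lra.
Qed.

Lemma le_exp2_eq0 (C x : R) : (forall n, `|x| <= C / 2 ^+ n) -> x = 0.
Proof.
move=> xC; apply/eqP; rewrite -normr_eq0 eq_le normr_ge0 andbT.
apply/ler_addgt0Pl => e e0; rewrite addr0.
have C0 : 0 <= C by have := xC 0%N; rewrite expr0 divr1; apply: le_trans.
apply: le_trans (xC (Num.bound (C / e))) _.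
rewrite ler_pdivrMr ?exprn_gt0// mulrC -ler_pdivrMr//.
have : C / e < (Num.bound (C / e))%:R by apply: archi_boundP; rewrite divr_ge0// ltW.
move=> /ltW /le_trans; apply.
by rewrite -natrX ler_nat ltnW// ltn_expl.
Qed.

(** A locally uniform limit of continuous functions: [H] is locally bounded. *)
Lemma continuous_exp2_approx (V : nat -> R -> R) u (H : R -> R) (C : R) :
  0 <= C -> (forall n, continuous (V n)) -> continuous H ->
  (forall x, 0 <= H x) ->
  (forall n x, `|u x - V n x| <= C / 2 ^+ n * H x) -> continuous u.
Proof.
move=> C0 cV cH H0 uV x; apply/cvgrPdist_le => /= e e0.
pose B := C * (H x + 1).
have [n Bn] : exists n, B / 2 ^+ n <= e / 3.
  have B0 : 0 <= B by rewrite mulr_ge0// addr_ge0.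
  exists (Num.bound (B / (e / 3))).
  rewrite ler_pdivrMr ?exprn_gt0// mulrC -ler_pdivrMr ?divr_gt0//.
  have : B / (e / 3) < (Num.bound (B / (e / 3)))%:R.
    by apply: archi_boundP; rewrite !divr_ge0// ltW.
  move=> /ltW /le_trans; apply.
  by rewrite -natrX ler_nat ltnW// ltn_expl.
have small t : H t <= H x + 1 -> `|u t - V n t| <= e / 3.
  move=> Ht; apply: le_trans (uV n t) _; apply: le_trans Bn.
  by rewrite /B mulrAC ler_wpM2r ?invr_ge0 ?exprn_ge0// ler_wpM2l.
have e3 : 0 < e / 3 by rewrite divr_gt0.
have nH : \forall t \near x, `|H x - H t| <= 1 by move/cvgrPdist_le : (cH x); exact.
have nV : \forall t \near x, `|V n x - V n t| <= e / 3.
  by move/cvgrPdist_le : (cV n x); exact.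
near=> t.
have Ht : `|H x - H t| <= 1 by near: t.
have Vt : `|V n x - V n t| <= e / 3 by near: t.
have ux : `|u x - V n x| <= e / 3 by apply: small; rewrite lerDl.
have ut : `|u t - V n t| <= e / 3.
  by apply: small; move: Ht; rewrite ler_norml => /andP[? ?]; lra.
move: Vt ux ut; rewrite !ler_norml => /andP[? ?] /andP[? ?] /andP[? ?].
by apply/andP; split; lra.
Unshelve. all: by end_near. Qed.
End comparison.

Section picard.
Context {R : realType}.
Variables (k : R -> R) (M y0 y1 : R).
Hypotheses (ck : continuous k) (kM : forall x, `|k x| <= M) (M1 : 1 <= M).
Implicit Types (f u v : R -> R) (x s : R).

Let I f : R -> R := xget (cst 0) [set F | has_deriv F f /\ F 0 = 0].

Let I_spec f : continuous f -> has_deriv (I f) f /\ I f 0 = 0.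
Proof.
move=> /primitive_exists[F Ff F0].
by apply: (@xgetPex _ (cst 0) [set F | has_deriv F f /\ F 0 = 0]); exists F.
Qed.

Let step v s := y0 + y1 * s + I (I (fun x => k x * v x)) s.

Let cM v : continuous v -> continuous (fun x => k x * v x).
Proof. by move=> cv x; apply: continuousM; [exact: ck|exact: cv]. Qed.

Let cI f : continuous f -> continuous (I f).
Proof. by move=> /I_spec[/has_deriv_cont]. Qed.

Let cstep v : continuous v -> continuous (step v).
Proof.
move=> cv; have [dI _] := I_spec (cI (cM cv)).
apply: (@has_deriv_cont _ _ (fun x => y1 + I (fun x => k x * v x) x)) => x.
by rewrite /step; der; ring.
Qed.

Let V n := iter n step (cst 0).

Let cV n : continuous (V n).
Proof.
rewrite /V; elim: n => [|n IHn] /=; last exact: cstep.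
by move=> x; exact: cvg_cst.
Qed.

Let L := 2 * M.
Let H s := expR (L * s) + expR (- (L * s)).

Let H_ge s : 1 <= H s /\ `|s| <= H s.
Proof.
have L1 : 1 <= L by rewrite /L; move: M1; lra.
have Ls : `|s| <= `|L * s| by rewrite normrM ler_peMl// ger0_norm//; lra.
have := expR_ge1Dx `|L * s|; rewrite /H.
have := expR_ge0 (L * s); have := expR_ge0 (- (L * s)).
have := normr_ge0 (L * s).
by move: Ls; have [_|_] := ger0P (L * s) => *; split; lra.
Qed.

Let H0 s : 0 <= H s. Proof. by have [h _] := H_ge s; exact: le_trans h. Qed.

(** In the norm weighted by [H = expR (L s) + expR (- L s)] a Picard step is a
    contraction on the whole line: [H'' = L^2 H], and [L = 2 M] makes [M / L^2
    <= 1 / 2]. *)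
Let contraction u v (c : R) : continuous u -> continuous v -> 0 <= c ->
  (forall x, `|u x - v x| <= c * H x) ->
  forall x, `|step u x - step v x| <= c / 2 * H x.
Proof.
move=> cu cv c0 uv x.
have [dIu Iu0] := I_spec (cM cu); have [dIv Iv0] := I_spec (cM cv).
have [dIIu IIu0] := I_spec (cI (cM cu)); have [dIIv IIv0] := I_spec (cI (cM cv)).
have dH : has_deriv H (fun t => L * (expR (L * t) - expR (- (L * t)))).
  by move=> t; rewrite ?/H; der; ring.
have dH1 : has_deriv (fun t => L * (expR (L * t) - expR (- (L * t))))
    (fun t => L ^+ 2 * H t).
  by move=> t; rewrite /H; der; ring.
have := @deriv2_le R (fun t => step u t - step v t)
   (fun t => I (fun x => k x * u x) t - I (fun x => k x * v x) t)
   (fun t => k t * u t - k t * v t)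
   (fun t => c / 2 * H t) (fun t => c / 2 * (L * (expR (L * t) - expR (- (L * t)))))
   (fun t => c / 2 * (L ^+ 2 * H t)) x.
have c2 : 0 <= c / 2 by rewrite divr_ge0.
have cH : 0 <= c / 2 * H 0 by rewrite mulr_ge0.
move=> h; apply: le_trans (h _ _ _ _ _ _ _ _) _; last by rewrite gerBl.
- by move=> t; rewrite /step; der; ring.
- by move=> t; der.
- by move=> t; rewrite /step; der; ring.
- by move=> t; der; rewrite /H; ring.
- by rewrite /step IIu0 IIv0; ring.
- by rewrite Iu0 Iv0 subrr.
- by rewrite mulr0 oppr0 subrr !mulr0.
move=> t; rewrite -mulrBr normrM.
apply: (@le_trans _ _ (M * (c * H t))); first by apply: ler_pM.
rewrite (_ : c / 2 * (L ^+ 2 * H t) = 2 * M ^+ 2 * (c * H t)); last by rewrite /L; field.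
rewrite ler_wpM2r ?mulr_ge0//; have := M1; nra.
Qed.

Let A : R := `|y0| + `|y1|.
Let A0 : 0 <= A. Proof. by rewrite addr_ge0. Qed.

Let V_step n s : `|V n.+1 s - V n s| <= A / 2 ^+ n * H s.
Proof.
elim: n s => [|n IHn] s.
  rewrite /V /= /step (_ : (fun x => k x * cst 0 x) = cst 0); last first.
    by apply/funext => t; rewrite mulr0.
  rewrite subr0 expr0 divr1.
  have zero f t : has_deriv f (cst 0) -> f 0 = 0 -> f t = 0.
    by move=> /(@has_deriv0_cst _ _ _ t 0) /(_ (fun=> erefl)) ->.
  have [d0 I0] := I_spec (@cst_continuous R R 0).
  have I00 : I (cst 0) = cst 0 by apply/funext => t; exact: zero.
  rewrite I00 -[I _ s]/(I (cst 0) s) I00 addr0.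
  have [h1 h2] := H_ge s.
  apply: le_trans (ler_normD _ _) _; rewrite mulrDl lerD// ?normrM.
    by rewrite ler_peMr.
  by rewrite ler_wpM2l.
have -> : A / 2 ^+ n.+1 = A / 2 ^+ n / 2 by rewrite exprS; field.
have h := @contraction (V n.+1) (V n) (A / 2 ^+ n) (@cV n.+1) (@cV n).
by apply: h => //; rewrite divr_ge0// exprn_ge0.
Qed.

(* V n s is Cauchy with explicit rate; the sup of the increasing sequence of lower
   bounds that the rate gives is its limit. *)
Let u s := sup [set V n s - 2 * (A / 2 ^+ n * H s) | n in setT].

Let u_V n s : `|u s - V n s| <= 2 * A / 2 ^+ n * H s.
Proof.
pose e n := A / 2 ^+ n * H s.
have eS m : e m = 2 * e m.+1 by rewrite /e exprS; field; rewrite expf_neq0.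
have e0 m : 0 <= e m by rewrite mulr_ge0// divr_ge0// exprn_ge0.
have mono m p : (m <= p)%N ->
    V m s - 2 * e m <= V p s - 2 * e p /\ V p s + 2 * e p <= V m s + 2 * e m.
  elim: p => [|p IHp]; first by rewrite leqn0 => /eqP ->.
  rewrite leq_eqVlt => /predU1P[->//|]; rewrite ltnS => /IHp[h1 h2].
  have := V_step p s; rewrite -/(e p) ler_norml => /andP[? ?].
  by have := eS p; have := e0 p; split; lra.
have cross m p : V m s - 2 * e m <= V p s + 2 * e p.
  have [/mono[h1 h2]|/ltnW/mono[h1 h2]] := leqP m p.
    by have := e0 p; lra.
  by have := e0 m; lra.
have ub p : ubound [set V n s - 2 * (A / 2 ^+ n * H s) | n in setT] (V p s + 2 * e p).
  by move=> _ [m _ <-]; exact: cross.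
have h1 : V n s - 2 * e n <= u s.
  apply: sup_upper_bound; last by exists n.
  split; last by exists (V 0 s + 2 * e 0%N).
  by exists (V 0 s - 2 * (A / 2 ^+ 0 * H s)); exists 0%N.
have h2 : u s <= V n s + 2 * e n.
  by apply: ge_sup; [exists (V 0 s - 2 * (A / 2 ^+ 0 * H s)); exists 0%N|exact: ub].
have -> : 2 * A / 2 ^+ n * H s = 2 * e n by rewrite /e; ring.
by rewrite ler_norml; apply/andP; split; lra.
Qed.

Lemma linear_ode_exists_bounded : exists v v1 : R -> R,
  [/\ has_deriv v v1, has_deriv v1 (fun x => k x * v x), v 0 = y0 & v1 0 = y1].
Proof.
have cH : continuous H.
  apply: (@has_deriv_cont _ _ (fun t => L * (expR (L * t) - expR (- (L * t))))) => t.
  by rewrite ?/H; der; ring.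
have A2 : 0 <= 2 * A by rewrite mulr_ge0.
have cu : continuous u := continuous_exp2_approx A2 cV cH H0 u_V.
have stepu s : step u s = u s.
  apply/eqP; rewrite -subr_eq0; apply/eqP; apply: (@le_exp2_eq0 R (4 * A * H s)) => n.
  have h1 : `|step u s - V n.+1 s| <= 2 * A / 2 ^+ n / 2 * H s.
    have h := @contraction u (V n) (2 * A / 2 ^+ n) cu (@cV n).
    by apply: h => //; rewrite divr_ge0// exprn_ge0.
  have h2 := u_V n.+1 s.
  have -> : step u s - u s = (step u s - V n.+1 s) - (u s - V n.+1 s) by ring.
  apply: le_trans (ler_normB _ _) _.
  rewrite exprS in h2.
  have e0 : 0 <= A / 2 ^+ n * H s by rewrite mulr_ge0// divr_ge0// exprn_ge0.
  have -> : 4 * A * H s / 2 ^+ n = 4 * (A / 2 ^+ n * H s) by ring.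
  have h1' : `|step u s - V n.+1 s| <= A / 2 ^+ n * H s.
    apply: le_trans h1 _; rewrite le_eqVlt; apply/orP; left; apply/eqP.
    by field; rewrite expf_neq0.
  have h2' : `|u s - V n.+1 s| <= A / 2 ^+ n * H s.
    apply: le_trans h2 _; rewrite le_eqVlt; apply/orP; left; apply/eqP.
    by field; rewrite expf_neq0.
  by lra.
have [dI I0] := I_spec (cM cu); have [dII II0] := I_spec (cI (cM cu)).
exists u, (fun s => y1 + I (fun x => k x * u x) s); split.
- rewrite -{1}(funext stepu) => s; rewrite /step.
  by rewrite ?/H; der; ring.
- by move=> s; der; ring.
- by rewrite -stepu /step II0; ring.
- by rewrite I0 addr0.
Qed.
End picard.

(** * Second-order linear equations: energy estimate; periodic functions *)

Section energy.
Context {R : realType}.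
Implicit Types (f g k u v D : R -> R) (x a b c s m M S e : R).

(** Gronwall's argument for [D^2 + D'^2 + e^2]. Keeping the forcing term in the
    estimate makes solutions Lipschitz in a parameter; with [e = 0] it gives
    uniqueness. *)
Lemma energy_le k f D D1 M e S : has_deriv D D1 ->
  (forall x, 0 <= x <= S -> is_derive x (1 : R) D1 (k x * D x + f x)) ->
  (forall x, 0 <= x <= S -> `|k x| <= M /\ `|f x| <= e) -> 0 <= S ->
  D S ^+ 2 + D1 S ^+ 2 + e ^+ 2 <=
    (D 0 ^+ 2 + D1 0 ^+ 2 + e ^+ 2) * expR ((M + 2) * S).
Proof.
move=> dD dD1 kf S0.
pose N x := D x ^+ 2 + D1 x ^+ 2 + e ^+ 2.
have : - (N 0 * expR (- ((M + 2) * 0))) <= - (N S * expR (- ((M + 2) * S))).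
  apply: (@is_derive_le R (fun x => - (N x * expR (- ((M + 2) * x))))
     (fun x => expR (- ((M + 2) * x)) * ((M + 2) * N x
       - (2 * D x * D1 x + 2 * D1 x * (k x * D x + f x))))) => // x xS.
    by have dD1x := dD1 x xS; rewrite /N; der; ring.
  have [kM fe] := kf x xS; rewrite mulr_ge0 ?expR_ge0//.
  have f2 : f x ^+ 2 <= e ^+ 2.
    by rewrite -[f x ^+ 2]real_normK ?num_real// ler_pXn2r ?nnegrE// (le_trans _ fe).
  have M0 : 0 <= M by apply: le_trans kM.
  (* 2 D D' <= D^2 + D'^2 and 2 D' f <= D'^2 + f^2 *)
  have kDD : `|2 * D x * D1 x * k x| <= (D x ^+ 2 + D1 x ^+ 2) * M.
    rewrite normrM ler_pM//.
    rewrite ler_norml; apply/andP; split.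
      by have := sqr_ge0 (D x + D1 x); lra.
    by have := sqr_ge0 (D x - D1 x); lra.
  move: kDD; rewrite ler_norml => /andP[_ kDD].
  have h1 : 0 <= (D x - D1 x) ^+ 2 := sqr_ge0 _.
  have h2 : 0 <= (D1 x - f x) ^+ 2 := sqr_ge0 _.
  have h3 : 0 <= M * e ^+ 2 by rewrite mulr_ge0// sqr_ge0.
  have h4 : 0 <= D x ^+ 2 := sqr_ge0 _.
  by have h5 : 0 <= e ^+ 2 := sqr_ge0 _; rewrite /N; lra.
rewrite mulr0 oppr0 expR0 mulr1 lerN2 expRN -/(N S) -/(N 0).
by rewrite ler_pdivrMr ?expR_gt0.
Qed.

(** The energy estimate for [s >= 0]; the reflection of [D] reduces [s < 0] to
    it. *)
Lemma linear_ode_zero k D D1 M s : has_deriv D D1 ->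
  has_deriv D1 (fun x => k x * D x) -> (forall x, `|k x| <= M) ->
  D 0 = 0 -> D1 0 = 0 -> D s = 0 /\ D1 s = 0.
Proof.
move=> dD dD1 kM D0 D10.
have pos k' E E1 S : has_deriv E E1 -> has_deriv E1 (fun x => k' x * E x) ->
    (forall x, `|k' x| <= M) -> E 0 = 0 -> E1 0 = 0 -> 0 <= S -> E S = 0 /\ E1 S = 0.
  move=> dE dE1 k'M E0 E10 S0.
  have := @energy_le k' (cst 0) E E1 M 0 S dE _ _ S0.
  have d x : 0 <= x <= S -> is_derive x (1 : R) E1 (k' x * E x + cst 0 x).
    by move=> _; rewrite addr0; exact: dE1.
  have b x : 0 <= x <= S -> `|k' x| <= M /\ `|(cst 0 x : R)| <= 0.
    by move=> _; rewrite normr0.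
  move=> /(_ d b); rewrite E0 E10 !expr0n/= !addr0 mul0r.
  have := sqr_ge0 (E S); have := sqr_ge0 (E1 S) => h1 h2 h3.
  by split; apply/eqP; rewrite -sqrf_eq0 eq_le; apply/andP; split => //; lra.
have [s0|s0] := leP 0 s; first exact: (pos k).
have [||||||e1 e2] := pos (fun x => k (- x)) (fun x => D (- x))
  (fun x => - D1 (- x)) (- s).
- by move=> x; der; ring.
- by move=> x; der; ring.
- by move=> x; exact: kM.
- by rewrite oppr0.
- by rewrite oppr0 D10 oppr0.
- by rewrite oppr_ge0 ltW.
by move: e1 e2; rewrite !opprK => -> /eqP; rewrite oppr_eq0 => /eqP.
Qed.

Lemma wronskian k u u1 v v1 s : has_deriv u u1 -> has_deriv u1 (fun x => k x * u x) ->
  has_deriv v v1 -> has_deriv v1 (fun x => k x * v x) ->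
  u s * v1 s - u1 s * v s = u 0 * v1 0 - u1 0 * v 0.
Proof.
move=> du du1 dv dv1.
apply: (@has_deriv0_cst R (fun x => u x * v1 x - u1 x * v x) (cst 0)) => // x.
by der; rewrite /=; ring.
Qed.

Lemma cont_bounded f a b : continuous f -> exists M, forall x, a <= x <= b -> `|f x| <= M.
Proof.
move=> cf; have [ab|ba] := leP a b; last first.
  by exists 0 => x /andP[ax xb]; have := le_trans ax xb; rewrite leNgt ba.
have cn : {within `[a, b], continuous (fun x => `|f x|)}.
  by apply: continuous_subspaceT => x; apply: cvg_norm; exact: cf.
by have [c _ h] := EVT_max ab cn; exists `|f c| => x xab; apply: h; rewrite in_itv.
Qed.

End energy.

Section periodic.
Context {R : realType}.
Implicit Types (ell x : R).

Lemma periodic_int (V : zmodType) (f : R -> V) ell (n : int) x :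
  periodic f ell -> f (x + n%:~R * ell) = f x.
Proof.
move=> pf; case: n => n.
  by rewrite -pmulrn mulr_natl periodicn.
rewrite NegzE mulrNz -pmulrn mulNr mulr_natl.
by rewrite -[x in RHS](subrK (ell *+ n.+1)) periodicn.
Qed.

Lemma periodic_rep (V : zmodType) (f : R -> V) ell x : 0 < ell -> periodic f ell ->
  exists2 y, 0 <= y < ell & f x = f y.
Proof.
move=> ell0 pf; pose n := Num.floor (x / ell).
have /andP[h1 h2] := Num.Theory.floor_itv (x / ell); rewrite -/n in h1 h2.
exists (x + (- n)%:~R * ell); last by rewrite periodic_int.
move: h1 h2; rewrite ler_pdivlMr// ltr_pdivrMr// intrD mulrDl mul1r.
by rewrite mulrNz mulNr subr_ge0 => -> /=; lra.
Qed.

Lemma periodic_bounded (f : R -> R) ell : 0 < ell -> periodic f ell ->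
  continuous f -> exists M, forall x, `|f x| <= M.
Proof.
move=> ell0 pf cf; have [M fM] := @cont_bounded R f 0 ell cf.
exists M => x; have [y /andP[y0 yl] ->] := periodic_rep x ell0 pf.
by apply: fM; rewrite y0 ltW.
Qed.

Lemma periodic_deriv (f df : R -> R) ell : periodic f ell -> has_deriv f df ->
  periodic df ell.
Proof.
move=> pf fdf x; have [_ <-] := fdf x.
have h : is_derive x (1 : R) (fun t => f (t + ell)) (df (x + ell)) by der; ring.
have -> : f = fun t => f (t + ell) by apply/funext => t; rewrite pf.
by have [_ <-] := h.
Qed.

Lemma periodic_primitive_shift (F f : R -> R) ell a : periodic f ell ->
  has_deriv F f -> F (a + ell) - F a = F ell - F 0.
Proof.
move=> pf Ff.
rewrite -[ell in RHS]add0r.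
apply: (@has_deriv0_cst R (fun t => F (t + ell) - F t) (fun t => f (t + ell) - f t)).
  by move=> x; der; ring.
by move=> x; rewrite pf subrr.
Qed.
End periodic.

(** * A periodic solution of Hill's equation *)

Section hill.
Context {R : realType}.
Variables (ell : R) (q B : R -> R) (Q : R).
Hypotheses (ell0 : 0 < ell) (cq : continuous q) (pq : periodic q ell).
Hypotheses (qQ : forall x, `|q x| <= Q) (dB : has_deriv B q).
Implicit Types (m x s : R) (u v : R -> R).

Let sol m u v := has_deriv u v /\ has_deriv v (fun x => (m - q x) * u x).

Let coef_le m x : `|m - q x| <= `|m| + Q.
Proof. by apply: le_trans (ler_normB _ _) _; rewrite lerD2l. Qed.

Let Q0 : 0 <= Q. Proof. exact: le_trans (qQ 0). Qed.

Lemma hill_solution m y0 y1 : exists uv : (R -> R) * (R -> R),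
  sol m uv.1 uv.2 /\ (uv.1 0 = y0 /\ uv.2 0 = y1).
Proof.
have ck : continuous (fun x => m - q x).
  by move=> x; apply: continuousB; [exact: cst_continuous|exact: cq].
have kM x : `|m - q x| <= `|m| + Q + 1 by rewrite ler_wpDr.
have M1 : 1 <= `|m| + Q + 1 by rewrite lerDr addr_ge0.
have [u [v [? ? ? ?]]] := linear_ode_exists_bounded y0 y1 ck kM M1.
by exists (u, v).
Qed.

Let hill_unique m u v s : sol m u v -> u 0 = 0 -> v 0 = 0 -> u s = 0 /\ v s = 0.
Proof. by move=> [du dv] u0 v0; exact: linear_ode_zero du dv (coef_le m) u0 v0. Qed.

Section parameter.
Variables (y0 y1 : R) (u v : R -> R -> R).
Hypotheses (uv : forall m, sol m (u m) (v m)).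
Hypotheses (u0 : forall m, u m 0 = y0) (v0 : forall m, v m 0 = y1).

(** The difference of two solutions solves the equation for [m] with the forcing
    term [(m - m0) * u m0]. *)
Lemma hill_lipschitz m0 : exists2 K, 0 <= K & forall m s, `|m - m0| <= 1 ->
  0 <= s <= ell -> `|u m s - u m0 s| <= K * `|m - m0| /\
                   `|v m s - v m0 s| <= K * `|m - m0|.
Proof.
have [du0 dv0] := uv m0.
have [b ub] := @cont_bounded R (u m0) 0 ell (has_deriv_cont du0).
have b0 : 0 <= b by apply: le_trans (ub 0 _); rewrite // lexx ltW.
pose M := `|m0| + 1 + Q; pose E := expR ((M + 2) * ell).
have M0 : 0 <= M by rewrite !addr_ge0.
have E1 : 1 <= E by rewrite /E -expR0 ler_expR mulr_ge0 ?addr_ge0// ltW.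
exists (b * E) => [|m s mm0 /andP[s0 sl]]; first by rewrite mulr_ge0// (le_trans _ E1).
have [du dv] := uv m.
set e := `|m - m0| * b.
have e0 : 0 <= e by rewrite mulr_ge0.
have := @energy_le R (fun x => m - q x) (fun x => (m - m0) * u m0 x)
  (fun x => u m x - u m0 x) (fun x => v m x - v m0 x) M e s.
have d1 : has_deriv (fun x => u m x - u m0 x) (fun x => v m x - v m0 x).
  by move=> x; der.
have d2 x : 0 <= x <= s -> is_derive x (1 : R) (fun x => v m x - v m0 x)
    ((m - q x) * (u m x - u m0 x) + (m - m0) * u m0 x).
  by move=> _; der; ring.
have bnd x : 0 <= x <= s -> `|m - q x| <= M /\ `|(m - m0) * u m0 x| <= e.
  move=> /andP[x0 xs]; split; last first.
    by rewrite normrM ler_wpM2l// ub// x0 (le_trans xs).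
  apply: le_trans (coef_le m x) _; rewrite /M lerD2r.
  have -> : m = m0 + (m - m0) by ring.
  by apply: le_trans (ler_normD _ _) _; rewrite lerD2l.
move=> /(_ d1 d2 bnd s0); rewrite !u0 !v0 !subrr !expr0n/= !add0r => h.
have h2 : e ^+ 2 * expR ((M + 2) * s) <= (e * E) ^+ 2.
  rewrite [leRHS]exprMn ler_wpM2l ?sqr_ge0//.
  apply: (@le_trans _ _ E); first by rewrite ler_expR ler_wpM2l// addr_ge0.
  by rewrite expr2 ler_peMr// (le_trans _ E1).
have -> : b * E * `|m - m0| = e * E by rewrite /e; ring.
have eE : 0 <= e * E by rewrite mulr_ge0// (le_trans _ E1).
have s1 := sqr_ge0 (u m s - u m0 s); have s2 := sqr_ge0 (v m s - v m0 s).
have s3 := sqr_ge0 e.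
have sq (y : R) : y ^+ 2 <= (e * E) ^+ 2 -> `|y| <= e * E.
  by rewrite -[y ^+ 2]real_normK ?num_real// ler_pXn2r ?nnegrE.
by split; apply: sq; lra.
Qed.
End parameter.

Let sqr_ge1_ge1 u v s : has_deriv u v -> 0 <= s -> 1 <= u 0 ->
  (forall x, 0 <= x <= s -> 1 <= u x ^+ 2) -> 1 <= u s.
Proof.
move=> du s0 u0 u2; rewrite leNgt; apply/negP => us.
have us' : u s < 0.
  have := u2 s; rewrite s0 lexx => /(_ isT) h; rewrite ltNge; apply/negP => us0.
  by have : u s ^+ 2 < 1; [rewrite expr_lt1|rewrite ltNge h].
have [|c] := @IVT R u 0 s 0 s0 (has_deriv_within du).
  by rewrite ge_min le_max; apply/andP; split; apply/orP; [right|left]; lra.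
rewrite in_itv/= => cs uc0; have := u2 c cs.
by rewrite uc0 expr0n/= ler10.
Qed.

Let C_spec m := cid (hill_solution m 1 0).
Let S_spec m := cid (hill_solution m 0 1).
Let C m := (sval (C_spec m)).1.
Let C' m := (sval (C_spec m)).2.
Let S m := (sval (S_spec m)).1.
Let S' m := (sval (S_spec m)).2.
Let solC m : sol m (C m) (C' m). Proof. exact: (svalP (C_spec m)).1. Qed.
Let solS m : sol m (S m) (S' m). Proof. exact: (svalP (S_spec m)).1. Qed.
Let C0 m : C m 0 = 1. Proof. exact: (svalP (C_spec m)).2.1. Qed.
Let C'0 m : C' m 0 = 0. Proof. exact: (svalP (C_spec m)).2.2. Qed.
Let S0 m : S m 0 = 0. Proof. exact: (svalP (S_spec m)).2.1. Qed.
Let S'0 m : S' m 0 = 1. Proof. exact: (svalP (S_spec m)).2.2. Qed.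

Let wronskianCS m s : C m s * S' m s - C' m s * S m s = 1.
Proof.
have [dC dC'] := solC m; have [dS dS'] := solS m.
by rewrite (wronskian s dC dC' dS dS') C0 S'0 C'0 mul0r subr0 mulr1.
Qed.

Let disc m := C m ell + S' m ell.

Let disc_continuous : continuous disc.
Proof.
move=> m0; apply/cvgrPdist_le => /= e e0.
have [K K0 hK] := hill_lipschitz solC C0 C'0 m0.
have [K' K'0 hK'] := hill_lipschitz solS S0 S'0 m0.
pose d := Num.min 1 (e / (K + K' + 1)).
have KK : 0 < K + K' + 1 by rewrite ltr_wpDl// addr_ge0.
have d0 : 0 < d by rewrite lt_min ltr01 divr_gt0.
near=> m.
have md : `|m - m0| <= d by rewrite distrC; near: m; exact: cvgr_dist_le.
have [md1 mde] : `|m - m0| <= 1 /\ `|m - m0| <= e / (K + K' + 1).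
  by split; apply: le_trans md _; rewrite ge_min lexx ?orbT.
have l0 : 0 <= ell <= ell by rewrite lexx ltW.
have [h1 _] := hK m ell md1 l0; have [_ h2] := hK' m ell md1 l0.
have h3 : (K + K' + 1) * `|m - m0| <= e by rewrite mulrC -ler_pdivlMr.
have h4 := normr_ge0 (m - m0).
rewrite /disc distrC.
rewrite (_ : _ - _ = (C m ell - C m0 ell) + (S' m ell - S' m0 ell)); last by ring.
by apply: le_trans (ler_normD _ _) _; lra.
Unshelve. all: by end_near. Qed.

(** Above the potential, [u * u'] is nondecreasing for every solution [u], so
    [C^2] and [S'^2] are too. *)
Let large_param m : Q <= m ->
  2 <= disc m /\ forall s, 0 < s <= ell -> 0 < S m s.
Proof.
move=> Qm; have k0 x : 0 <= m - q x.
  by have := qQ x; rewrite ler_norml => /andP[_ h]; lra.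
have uv0 u v : sol m u v -> 0 <= u 0 * v 0 -> forall s, 0 <= s -> 0 <= u s * v s.
  move=> [du dv] i0 s s0; apply: le_trans i0 _.
  apply: (@has_deriv_le R (fun x => u x * v x)
      (fun x => v x ^+ 2 + (m - q x) * u x ^+ 2)) => // [x|x _].
    by der; ring.
  by rewrite addr_ge0// ?sqr_ge0// mulr_ge0// sqr_ge0.
have [dC dC'] := solC m; have [dS dS'] := solS m.
have Cge s : 0 <= s -> 1 <= C m s.
  move=> s0; apply: (sqr_ge1_ge1 dC s0); first by rewrite C0.
  move=> x /andP[x0 xs]; rewrite -[leLHS](expr1n R 2) -(C0 m).
  apply: (@has_deriv_le R (fun x => C m x ^+ 2) (fun x => 2 * (C m x * C' m x))) => //.
    by move=> t; der; ring.
  move=> t /andP[t0 tx]; rewrite mulr_ge0//; apply: (uv0 _ _ (solC m)) => //.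
  by rewrite C'0 mulr0.
have S'ge s : 0 <= s -> 1 <= S' m s.
  move=> s0; apply: (sqr_ge1_ge1 dS' s0); first by rewrite S'0.
  move=> x /andP[x0 xs]; rewrite -[leLHS](expr1n R 2) -(S'0 m).
  apply: (@has_deriv_le R (fun x => S' m x ^+ 2)
    (fun x => 2 * (m - q x) * (S m x * S' m x))) => //.
    by move=> t; der; ring.
  move=> t /andP[t0 tx]; apply: mulr_ge0; first exact: mulr_ge0.
  apply: (uv0 _ _ (solS m)) => //.
  by rewrite S0 mul0r.
split; first by have := Cge ell (ltW ell0); have := S'ge ell (ltW ell0); rewrite /disc; lra.
move=> s /andP[s0 sl].
have : S m 0 - 0 <= S m s - s.
  apply: (@has_deriv_le R (fun x => S m x - x) (fun x => S' m x - 1)); [exact: ltW| |].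
    by move=> t; der; ring.
  by move=> t /andP[t0 _]; rewrite subr_ge0 S'ge.
by rewrite S0; lra.
Qed.

Let m0 := (B ell - B 0) / ell.

(** The solution equal to 1 at both ends of a period is positive, and its
    logarithmic derivative [w] satisfies [w' = m0 - q - w^2]. At the mean [m0]
    of [q] this gives [v' ell <= v' 0], which says that the discriminant is at
    most 2. *)
Let disc_mean_le2 : (forall s, 0 < s <= ell -> 0 < S m0 s) -> disc m0 <= 2.
Proof.
move=> Spos; have [dC dC'] := solC m0; have [dS dS'] := solS m0.
have Sl : 0 < S m0 ell by apply: Spos; rewrite ell0 lexx.
pose a := (1 - C m0 ell) / S m0 ell.
pose v x := C m0 x + a * S m0 x; pose v' x := C' m0 x + a * S' m0 x.
have dv : has_deriv v v' by move=> x; rewrite /v /v'; der; ring.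
have dv' : has_deriv v' (fun x => (m0 - q x) * v x) by move=> x; rewrite /v /v'; der; ring.
have v0 : v 0 = 1 by rewrite /v C0 S0 mulr0 addr0.
have vl : v ell = 1 by rewrite /v /a divfK ?gt_eqF//; ring.
have vpos x : 0 <= x <= ell -> 0 < v x.
  move=> /andP[x0 xl]; move: x0; rewrite le_eqVlt => /predU1P[<-|x0]; first by rewrite v0.
  have Sx : 0 < S m0 x by apply: Spos; rewrite x0.
  have W t : v t * S' m0 t - v' t * S m0 t = 1.
    by rewrite (wronskian t dv dv' dS dS') v0 S'0 S0 mulr0 subr0 mulr1.
  have : - (v x * (S m0 x)^-1) <= - (v ell * (S m0 ell)^-1).
    (* by the Wronskian identity, v / S decreases; it is positive at ell *)
    apply: (@is_derive_le R (fun t => - (v t * (S m0 t)^-1))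
      (fun t => S m0 t ^- 2)) => //.
    move=> t /andP[xt tl].
      have St : S m0 t != 0 by rewrite gt_eqF// Spos// (lt_le_trans x0 xt).
      have dV := is_deriveVf St (dS t).
      by der; rewrite -[RHS]mul1r -(W t); field.
    by move=> t _; rewrite invr_ge0 sqr_ge0.
  rewrite lerN2 vl mul1r => h; have : 0 < v x / S m0 x.
    by apply: lt_le_trans h; rewrite invr_gt0.
  by rewrite pmulr_lgt0// invr_gt0.
have : - (v' 0 * (v 0)^-1 + B 0 - m0 * 0) <= - (v' ell * (v ell)^-1 + B ell - m0 * ell).
  apply: (@is_derive_le R (fun t => - (v' t * (v t)^-1 + B t - m0 * t))
     (fun t => (v' t / v t) ^+ 2)); first exact: ltW.
    move=> t tl; have vt : v t != 0 by rewrite gt_eqF// vpos.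
    have dV := is_deriveVf vt (dv t).
    by der; field.
  by move=> t _; exact: sqr_ge0.
rewrite v0 vl invr1 !mulr1 mulr0 subr0 /m0 divfK ?gt_eqF// => h.
have {h} : v' ell - v' 0 <= 0 by lra.
have W := wronskianCS m0 ell.
rewrite /v' C'0 S'0 (_ : _ - _ = (disc m0 - 2) / S m0 ell).
  by rewrite pmulr_lle0 ?invr_gt0//; lra.
have -> : disc m0 - 2 = C' m0 ell * S m0 ell + (1 - C m0 ell) * (S' m0 ell - 1).
  by rewrite /disc; lra.
by rewrite /a; field; rewrite gt_eqF.
Qed.

(** If [S m0] has a zero on the period, [m1] is the largest [m] for which [S m]
    has one. That zero is then at [ell], so the monodromy matrix is triangular
    with determinant 1 and negative diagonal, and its trace is negative. *)
Let disc_le2 : exists2 m, m0 <= m <= Num.max m0 Q & disc m <= 2.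
Proof.
have [Spos|] := pselect (forall s, 0 < s <= ell -> 0 < S m0 s).
  by exists m0; [rewrite lexx le_max lexx|exact: disc_mean_le2].
move=> nSpos.
pose A := [set m | exists2 s : R, 0 < s <= ell & S m s <= 0].
have A0 : A m0.
  apply: contrapT => nA; apply: nSpos => s sl; rewrite ltNge; apply/negP => Ss.
  by apply: nA; exists s.
have AQ m : A m -> m <= Q.
  move=> [s sl Ss]; rewrite leNgt; apply/negP => /ltW /large_param[_ /(_ s sl)].
  by rewrite ltNge Ss.
have supA : has_sup A by split; [exists m0|exists Q].
pose m1 := sup A.
have m01 : m0 <= m1 by apply: sup_upper_bound.
have m1Q : m1 <= Q by apply: ge_sup; [exists m0|].
have above m s : m1 < m -> 0 < s <= ell -> 0 < S m s.
  move=> m1m sl; rewrite ltNge; apply/negP => Ss.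
  by have : m <= m1; [apply: sup_upper_bound => //; exists s|rewrite leNgt m1m].
have [K K0 hK] := hill_lipschitz solS S0 S'0 m1.
have [dS dS'] := solS m1.
have Sge0 s : 0 <= s <= ell -> 0 <= S m1 s.
  move=> /andP[s0 sl]; move: s0; rewrite le_eqVlt => /predU1P[<-|s0]; first by rewrite S0.
  apply/ler_addgt0Pl => e e0; rewrite addrC.
  pose d := Num.min 1 (e / (K + 1)).
  have K1 : 0 < K + 1 by rewrite ltr_wpDl.
  have d0 : 0 < d by rewrite lt_min ltr01 divr_gt0.
  have nd : `|m1 + d - m1| = d by rewrite addrAC subrr add0r gtr0_norm.
  have d1 : `|m1 + d - m1| <= 1 by rewrite nd ge_min lexx.
  have de : d <= e / (K + 1) by rewrite ge_min lexx orbT.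
  have [|h _] := hK (m1 + d) s d1; first by rewrite sl ltW.
  have : 0 < S (m1 + d) s by apply: above; rewrite ?s0// ltrDl.
  move: h; rewrite nd ler_norml => /andP[_ h].
  by move: de; rewrite ler_pdivlMr// => de; lra.
(* otherwise S m > 0 on (0, ell] also for m slightly below the supremum m1 *)
have [s sl Ss] : exists2 s : R, 0 < s <= ell & S m1 s = 0.
  apply: contrapT => nz.
  have Spos s : 0 < s <= ell -> 0 < S m1 s.
    move=> /andP[s0 sl]; rewrite lt_neqAle Sge0 ?(ltW s0)// andbT eq_sym.
    by apply/negP => /eqP Ss; apply: nz; exists s; rewrite ?s0.
  (* near 0 the slope of S m is what keeps it positive *)
  have [d /andP[d0 dl] hd] : exists2 d : R, 0 < d <= ell &
      forall x : R, 0 <= x <= d -> 1 / 2 <= S' m1 x.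
    have /cvgrPdist_le/(_ (1 / 2)) := @has_deriv_cont _ _ _ dS' 0.
    rewrite divr_gt0// => /(_ isT)[r /= r0 hr].
    exists (Num.min (r / 2) ell).
      by rewrite lt_min divr_gt0//= ell0 ge_min lexx orbT.
    move=> x /andP[x0]; rewrite le_min => /andP[xr _].
    have : `|S' m1 0 - S' m1 x| <= 1 / 2.
      by apply: hr; rewrite /= sub0r normrN ger0_norm//; lra.
    by rewrite S'0 ler_norml => /andP[? ?]; lra.
  have [c cdl hc] := EVT_min dl (has_deriv_within dS).
  have mn0 : 0 < S m1 c.
    by move: cdl; rewrite in_itv/= => /andP[? ?]; apply: Spos; rewrite (lt_le_trans d0).
  pose e := Num.min 1 (Num.min (1 / 4) (S m1 c / 2) / (K + 1)).
  have K1 : 0 < K + 1 by rewrite ltr_wpDl.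
  have e0 : 0 < e by rewrite lt_min ltr01 /= divr_gt0// lt_min !divr_gt0.
  have [m Am m1m] := sup_adherent e0 supA; rewrite -/m1 in m1m.
  have mm1 : m <= m1 by apply: sup_upper_bound.
  have nm : `|m - m1| < e by rewrite distrC ger0_norm ?subr_ge0//; lra.
  have [nm1] : `|m - m1| <= 1 /\ `|m - m1| <= Num.min (1 / 4) (S m1 c / 2) / (K + 1).
    by split; apply: le_trans (ltW nm) _; rewrite ge_min lexx ?orbT.
  rewrite ler_pdivlMr// le_min => /andP[nm2 nm3].
  have n0 := normr_ge0 (m - m1).
  have [dSm dSm'] := solS m.
  case: Am => s /andP[s0 sl]; apply/negP; rewrite -ltNge.
  have [sd|ds] := leP s d; last first.
    have [|h _] := hK m s nm1; first by rewrite sl ltW.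
    have : S m1 c <= S m1 s by apply: hc; rewrite in_itv/= (ltW ds).
    by move: h; rewrite ler_norml => /andP[? ?] ?; lra.
  have : S m 0 - 0 / 4 <= S m s - s / 4.
    apply: (@has_deriv_le R (fun x => S m x - x / 4) (fun x => S' m x - 1 / 4)).
    - exact: ltW.
    - by move=> x; der; ring.
    - move=> x /andP[x0 xs]; have xd := le_trans xs sd.
      have [|_ h] := hK m x nm1; first by rewrite x0 (le_trans xd).
      have : 1 / 2 <= S' m1 x by apply: hd; rewrite x0.
      by move: h; rewrite ler_norml => /andP[? ?] ?; lra.
  by rewrite S0; lra.
move: sl => /andP[s0 sl].
have W := wronskianCS m1 s; rewrite Ss mulr0 subr0 in W.
(* S m1 is nonnegative to the left of its zero s *)
have S's : S' m1 s <= 0.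
  rewrite leNgt; apply/negP => S's.
  have /cvgrPdist_lt/(_ _ S's)[r /= r0 hr] := @has_deriv_cont _ _ _ dS' s.
  pose d := Num.min (r / 2) s.
  have [d0 ds dr] : [/\ 0 < d, d <= s & d <= r / 2].
    by rewrite lt_min s0 divr_gt0//= !ge_min !lexx orbT.
  have sds : s - d <= s by rewrite gerBl ltW.
  have [c /andP[c1 c2]] := is_derive_MVT sds (fun x _ => dS x).
  rewrite Ss sub0r (_ : s - (s - d) = d); last by ring.
  move=> e.
  have c0 : 0 < S' m1 c.
    have : `|S' m1 s - S' m1 c| < S' m1 s.
      by apply: hr; rewrite /= ger0_norm; lra.
    by rewrite ltr_norml => /andP[? ?]; lra.
  have := Sge0 (s - d); rewrite subr_ge0 ds (le_trans sds)// => /(_ isT).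
  by have := mulr_gt0 c0 d0; lra.
exists m1; first by rewrite m01 le_max m1Q orbT.
(* an interior zero would be a minimum, hence a double zero *)
have se : s = ell.
  move: sl; rewrite le_eqVlt => /predU1P[//|sl]; exfalso.
  have S's0 : 0 <= S' m1 s.
    rewrite leNgt; apply/negP => S'n.
    have S'p : 0 < - S' m1 s by rewrite oppr_gt0.
    have /cvgrPdist_lt/(_ _ S'p)[r /= r0 hr] := @has_deriv_cont _ _ _ dS' s.
    pose d := Num.min (r / 2) (ell - s).
    have [d0 ds dr] : [/\ 0 < d, d <= ell - s & d <= r / 2].
      by rewrite lt_min subr_gt0 sl divr_gt0//= !ge_min !lexx orbT.
    have sds : s <= s + d by rewrite lerDl ltW.
    have [c /andP[c1 c2]] := is_derive_MVT sds (fun x _ => dS x).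
    rewrite Ss subr0 addrAC subrr add0r => e.
    have c0 : S' m1 c < 0.
      have : `|S' m1 s - S' m1 c| < - S' m1 s.
        by apply: hr; rewrite /= distrC ger0_norm; lra.
      by rewrite ltr_norml => /andP[? ?]; lra.
    have : 0 <= S m1 (s + d) by apply: Sge0; apply/andP; split; lra.
    by have : S' m1 c * d < 0; [rewrite nmulr_rlt0|rewrite e; lra].
  have S'z : S' m1 s = 0 by lra.
  by move: W; rewrite S'z mulr0 => /eqP; rewrite eq_sym oner_eq0.
rewrite se in W S's; rewrite /disc.
have : C m1 ell < 0.
  rewrite ltNge; apply/negP => C0'.
  by have := mulr_ge0_le0 C0' S's; rewrite W ler10.
by lra.
Qed.

(** The discriminant passes through 2 between the two preceding bounds; there
    the monodromy matrix has the eigenvalue 1. The bound on [m] is the one that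
    the Rayleigh quotient of the constants gives. *)
Lemma hill_periodic_solution : exists m u v,
  [/\ B ell - B 0 <= m * ell, has_deriv u v,
      has_deriv v (fun x => (m - q x) * u x), periodic u ell &
      exists x, u x != 0].
Proof.
have [m2 /andP[m02 m2Q] d2] := disc_le2.
have [||m] := @IVT R disc m2 (Num.max m0 Q) 2 m2Q.
- by apply: continuous_subspaceT; exact: disc_continuous.
- rewrite ge_min d2 le_max /=; apply/orP; right.
  by have [] // := @large_param (Num.max m0 Q); rewrite le_max lexx orbT.
rewrite in_itv/= => /andP[m2m _] dm.
have W := wronskianCS m ell.
have [dC dC'] := solC m; have [dS dS'] := solS m.
(* a fixed vector of the monodromy matrix, whose determinant is 1 and trace 2 *)
have [a [b [ab e1 e2]]] : exists a b, [/\ a != 0 \/ b != 0,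
    a * C m ell + b * S m ell = a & a * C' m ell + b * S' m ell = b].
  have [S_0|S_0] := eqVneq (S m ell) 0; last first.
    exists (S m ell), (1 - C m ell); split; [by left|by ring|].
    by move: dm; rewrite /disc => dm; lra.
  rewrite S_0 mulr0 subr0 in W.
  have C1 : C m ell = 1.
    have e : S' m ell = 2 - C m ell by move: dm; rewrite /disc; lra.
    by apply/eqP; rewrite -subr_eq0 -sqrf_eq0; apply/eqP; rewrite e in W; lra.
  exists 0, 1; split; [by right; exact: oner_neq0|by rewrite S_0; ring|].
  by move: dm; rewrite /disc C1; lra.
pose u x := a * C m x + b * S m x; pose v x := a * C' m x + b * S' m x.
have du : has_deriv u v by move=> x; rewrite /u /v; der; ring.
have dv : has_deriv v (fun x => (m - q x) * u x) by move=> x; rewrite /u /v; der; ring.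
have u0 : u 0 = a by rewrite /u C0 S0; ring.
have v0 : v 0 = b by rewrite /v C'0 S'0; ring.
exists m, u, v; split => //.
- by rewrite -ler_pdivrMr// -/m0; exact: le_trans m2m.
- move=> x.
  have sD : sol m (fun t => u (t + ell) - u t) (fun t => v (t + ell) - v t).
    by split => t; der; [ring|rewrite pq; ring].
  have [||h _] := hill_unique x sD.
  - by rewrite add0r u0 /u e1 subrr.
  - by rewrite add0r v0 /v e2 subrr.
  by apply/eqP; rewrite -subr_eq0 h.
- apply: contrapT => nz.
  have uz x : u x = 0 by apply/eqP/negPn/negP => ux; apply: nz; exists x.
  have vz x : v x = 0.
    have [_ <-] := du x; rewrite (_ : u = cst 0) ?derive_cst//; exact/funext.
  by case: ab; rewrite -?u0 -?v0 ?uz ?vz eqxx.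
Qed.
End hill.

(** * Wirtinger's inequality *)

Section wirtinger.
Context {R : realType}.
Implicit Types (f g F G P : R -> R) (a c h w x ell : R).

Lemma cos_midpoint_gt0 w h s a : 0 < h -> 0 < w -> w * h < pi -> a <= s <= a + h ->
  0 < cos (w * (s - (a + h / 2))).
Proof.
move=> h0 w0 wh /andP[s1 s2]; apply: cos_gt0_pihalf.
have l1 : w * (s - (a + h / 2)) <= w * (h / 2) by rewrite ler_pM2l//; lra.
have l2 : w * - (h / 2) <= w * (s - (a + h / 2)) by rewrite ler_pM2l//; lra.
by apply/andP; split; lra.
Qed.

(** For [w] below the critical frequency, [T = w tan (w (x - mid))] is bounded
    on the whole interval and [T' = w^2 + T^2], whence [g1^2 - w^2 g^2 + (g^2
    T)' = (g1 + g T)^2]. *)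
Lemma dirichlet_wirtinger_below g g1 P G a h w : 0 < h -> 0 < w -> w * h < pi ->
  has_deriv g g1 -> has_deriv P (fun x => g1 x ^+ 2) ->
  has_deriv G (fun x => g x ^+ 2) -> g a = 0 -> g (a + h) = 0 ->
  w ^+ 2 * (G (a + h) - G a) <= P (a + h) - P a.
Proof.
move=> h0 w0 wh dg dP dG ga gah.
pose T x := w * tan (w * (x - (a + h / 2))).
have : P a - w ^+ 2 * G a + g a ^+ 2 * T a <=
    P (a + h) - w ^+ 2 * G (a + h) + g (a + h) ^+ 2 * T (a + h).
  apply: (@is_derive_le R (fun x => P x - w ^+ 2 * G x + g x ^+ 2 * T x)
    (fun x => (g1 x + g x * T x) ^+ 2)).
  - by rewrite lerDl ltW.
  - move=> x xah; have cx := cos_midpoint_gt0 h0 w0 wh xah.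
    have dtan : is_derive x (1 : R) (fun x => tan (w * (x - (a + h / 2))))
        ((cos (w * (x - (a + h / 2)))) ^- 2 * w).
      have d := @is_derive_tan R (w * (x - (a + h / 2))) (lt0r_neq0 cx).
      by apply: (@is_derive_comp _ tan (fun x => w * (x - (a + h / 2))) x _ w d); der; ring.
    rewrite cos2_tan2 ?gt_eqF// in dtan.
    by rewrite /T; der; ring.
  - by move=> x _; exact: sqr_ge0.
by rewrite ga gah expr0n/= !mul0r !addr0 mulrBr; lra.
Qed.

(** The strict restriction [w < W] keeps the weights of the previous inequality
    bounded; it is removed by letting [w] tend to [W]. *)
Lemma le_sqr_scale_limit (W X Y : R) : 0 < W -> 0 <= X ->
  (forall w, 0 < w < W -> w ^+ 2 * X <= Y) -> W ^+ 2 * X <= Y.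
Proof.
move=> W0 X0 wY; rewrite leNgt; apply/negP => YZ.
set Z := W ^+ 2 * X in YZ.
have Y0 : 0 <= Y.
  apply: le_trans (wY (W / 2) _); last by lra.
  by rewrite mulr_ge0// sqr_ge0.
have Z0 : 0 < Z by lra.
pose y := Y / Z.
have [y0 y1] : 0 <= y /\ y < 1 by split; [rewrite divr_ge0// ltW|rewrite ltr_pdivrMr// mul1r].
have yZ : y * Z = Y by rewrite divfK ?gt_eqF.
have := wY ((y + 3) / 4 * W).
rewrite mulr_gt0//; last by lra.
rewrite gtr_pMl//; have -> /= : (y + 3) / 4 < 1 by lra.
move=> /(_ isT); rewrite exprMn -mulrA -/Z => h.
have h2 : ((y + 1) / 2) * Z <= ((y + 3) / 4) ^+ 2 * Z.
  by rewrite ler_wpM2r ?(ltW Z0)//; have := sqr_ge0 ((y + 3) / 4 - 1); lra.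
by lra.
Qed.

Lemma dirichlet_wirtinger g g1 P G a h : 0 < h ->
  has_deriv g g1 -> has_deriv P (fun x => g1 x ^+ 2) ->
  has_deriv G (fun x => g x ^+ 2) -> g a = 0 -> g (a + h) = 0 ->
  (pi / h) ^+ 2 * (G (a + h) - G a) <= P (a + h) - P a.
Proof.
move=> h0 dg dP dG ga gah; apply: le_sqr_scale_limit; first by rewrite divr_gt0// pi_gt0.
  rewrite subr_ge0; apply: (has_deriv_le _ dG); first by rewrite lerDl ltW.
  by move=> x _; exact: sqr_ge0.
move=> w /andP[w0 wh]; apply: (dirichlet_wirtinger_below h0 w0 _ dg dP dG ga gah).
by rewrite -ltr_pdivlMr.
Qed.

(** A periodic function takes some value [c] at two points half a period apart;
    the Dirichlet inequality applies to [f - c] on both half periods. *)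
Lemma wirtinger f f1 F P G ell : 0 < ell -> periodic f ell ->
  has_deriv f f1 -> has_deriv F f -> F ell = F 0 ->
  has_deriv P (fun x => f1 x ^+ 2) -> has_deriv G (fun x => f x ^+ 2) ->
  (2 * pi / ell) ^+ 2 * (G ell - G 0) <= P ell - P 0.
Proof.
move=> l0 pf df dF Fl dP dG; pose h := ell / 2.
have h0 : 0 < h by rewrite divr_gt0.
have hh x : x + h + h = x + ell by rewrite /h; lra.
have dphi : has_deriv (fun x => f (x + h) - f x) (fun x => f1 (x + h) - f1 x).
  by move=> x; der; ring.
(* f (x + ell / 2) - f x changes sign between 0 and ell / 2 *)
have [a _ fa] : exists2 a, a \in `[0, h]%R & f (a + h) - f a = 0.
  apply: IVT; [exact: ltW|exact: has_deriv_within dphi|].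
  have := hh 0; rewrite !add0r => ->; rewrite -[f ell]/(f ell) -(add0r ell) pf.
  rewrite ge_min le_max; have [c|c] := leP (f h) (f 0).
    by apply/andP; split; apply/orP; [left|right]; lra.
  by apply/andP; split; apply/orP; [right|left]; lra.
pose c := f a.
(* a primitive of (f - c)^2; as f has zero mean, its increment is at least that of G *)
pose G2 x := G x - 2 * c * F x + c ^+ 2 * x.
have dg : has_deriv (fun x => f x - c) f1 by move=> x; der; ring.
have dG2 : has_deriv G2 (fun x => (f x - c) ^+ 2) by move=> x; rewrite /G2; der; ring.
have g0 : f a - c = 0 by rewrite subrr.
have g1 : f (a + h) - c = 0 by rewrite -fa.
have g2 : f (a + h + h) - c = 0 by rewrite hh pf.
have i1 := dirichlet_wirtinger h0 dg dP dG2 g0 g1.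
have i2 := dirichlet_wirtinger h0 dg dP dG2 g1 g2.
rewrite (hh a) in i2.
have pf1 := periodic_deriv pf df.
have eP : P (a + ell) - P a = P ell - P 0.
  by apply: periodic_primitive_shift dP => x; rewrite pf1.
have eG : G2 (a + ell) - G2 a = G2 ell - G2 0.
  by apply: periodic_primitive_shift dG2 => x; rewrite pf.
have -> : 2 * pi / ell = pi / h by rewrite /h; field; rewrite gt_eqF.
set W := (pi / h) ^+ 2 in i1 i2 *.
have W0 : 0 <= W := sqr_ge0 _.
have : W * (G ell - G 0) <= W * (G2 ell - G2 0).
  rewrite ler_wpM2l// /G2 Fl.
  by have : 0 <= c ^+ 2 * ell by [rewrite mulr_ge0 ?sqr_ge0// ltW|]; lra.
by rewrite -eG -eP !mulrBr in i1 i2 *; lra.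
Qed.

(** The primitive is monotone with equal values at both ends of every period,
    hence constant. *)
Lemma periodic_null_integral G g ell : 0 < ell -> periodic g ell ->
  has_deriv G g -> (forall x : R, 0 <= g x) -> G ell = G 0 -> forall x, g x = 0.
Proof.
move=> l0 pg dG g0 Gl x.
have mono y z : y <= z -> G y <= G z by move=> yz; apply: (has_deriv_le yz dG).
have e := periodic_primitive_shift (x - ell / 2) pg dG.
have xe : x - ell / 2 + ell = x + ell / 2 by lra.
rewrite Gl subrr xe in e.
have cst_near : \forall t \near x, G t = cst (G x) t.
  have l2 : 0 < ell / 2 by rewrite divr_gt0.
  near=> t; have : `|x - t| <= ell / 2 by near: t; exact: cvgr_dist_le.
  rewrite ler_norml => /andP[? ?] /=; apply/eqP; rewrite eq_le; apply/andP.
  have h1 : G (x - ell / 2) <= G x by apply: mono; lra.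
  have h2 : G t <= G (x + ell / 2) by apply: mono; lra.
  have h3 : G (x - ell / 2) <= G t by apply: mono; lra.
  have h4 : G x <= G (x + ell / 2) by apply: mono; lra.
  by split; lra.
have [_ <-] := near_eq_is_derive cst_near (dG x).
by rewrite derive_cst.
Unshelve. all: by end_near. Qed.

Lemma linear_term_le0 (N M : R) :
  (forall e : R, 0 <= - (2 * e * N) + e ^+ 2 * M) -> N <= 0.
Proof.
move=> h; rewrite leNgt; apply/negP => N0.
have M0 : 0 < `|M| + 1 by rewrite ltr_wpDl.
have := h (N / (`|M| + 1)); set e := N / _.
have e0 : 0 < e by rewrite divr_gt0.
have eM : e * M <= N.
  apply: (@le_trans _ _ (e * (`|M| + 1))); last by rewrite divfK ?gt_eqF.
  by rewrite ler_wpM2l ?(ltW e0)//; have := ler_norm M; lra.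
have : e * (e * M) <= e * N by rewrite ler_wpM2l// ltW.
have : 0 < e * N by rewrite mulr_gt0.
by rewrite expr2 -mulrA; lra.
Qed.

(** Equality makes [f] a minimizer of the integral of [f1^2 - W f^2] among
    periodic functions of zero mean, and the first variation along [h = f2 + W
    f] is minus the integral of [h^2]. *)
Lemma wirtinger_eq f f1 f2 f3 F P G ell : 0 < ell -> periodic f ell ->
  has_deriv f f1 -> has_deriv f1 f2 -> has_deriv f2 f3 -> continuous f3 ->
  has_deriv F f -> F ell = F 0 ->
  has_deriv P (fun x => f1 x ^+ 2) -> has_deriv G (fun x => f x ^+ 2) ->
  P ell - P 0 = (2 * pi / ell) ^+ 2 * (G ell - G 0) ->
  forall x, f2 x = - (2 * pi / ell) ^+ 2 * f x.
Proof.
move=> l0 pf df df1 df2 cf3 dF Fl dP dG eq.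
have pf1 := periodic_deriv pf df; have pf2 := periodic_deriv pf1 df1.
set W := (2 * pi / ell) ^+ 2 in eq *.
(* f is varied in the direction of its own Euler-Lagrange defect h *)
pose h x := f2 x + W * f x; pose h1 x := f3 x + W * f1 x.
have dh : has_deriv h h1 by move=> x; rewrite /h /h1; der; ring.
have ph : periodic h ell by move=> x; rewrite /h pf2 pf.
have ch := has_deriv_cont dh; have cf := has_deriv_cont df.
have cf1 := has_deriv_cont df1.
have ch1 : continuous h1.
  move=> x; apply: cvgD; first exact: cf3.
  by apply: cvgM; [exact: cvg_cst|exact: cf1].
have cM (u v : R -> R) : continuous u -> continuous v -> continuous (fun x : R => u x * v x : R).
  by move=> cu cv x; apply: continuousM; [exact: cu|exact: cv].
have [Gh dGh _] := primitive_exists (cM _ _ ch ch).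
have [Ph dPh _] := primitive_exists (cM _ _ ch1 ch1).
have [Y dY _] := primitive_exists (cM _ _ cf ch).
have per (k : R -> R) : periodic k ell -> k ell = k 0 by move=> /(_ 0); rewrite add0r.
have Fh : f1 ell + W * F ell = f1 0 + W * F 0 by rewrite Fl (per _ pf1).
have N0 : Gh ell - Gh 0 <= 0.
  apply: (@linear_term_le0 _ (Ph ell - Ph 0 - W * (Gh ell - Gh 0))) => e.
  (* a primitive of f1 * h1, found by parts *)
  pose X x := f1 x * h x - Gh x + W * Y x.
  have := @wirtinger (fun x => f x + e * h x) (fun x => f1 x + e * h1 x)
    (fun x => F x + e * (f1 x + W * F x)) (fun x => P x + 2 * e * X x + e ^+ 2 * Ph x)
    (fun x => G x + 2 * e * Y x + e ^+ 2 * Gh x) ell l0.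
  have p1 : periodic (fun x => f x + e * h x) ell by move=> x; rewrite pf ph.
  have d1 : has_deriv (fun x => f x + e * h x) (fun x => f1 x + e * h1 x).
    by move=> x; der; ring.
  have d2 : has_deriv (fun x => F x + e * (f1 x + W * F x)) (fun x => f x + e * h x).
    by move=> x; der; rewrite /h; ring.
  have d3 : has_deriv (fun x => P x + 2 * e * X x + e ^+ 2 * Ph x)
      (fun x => (f1 x + e * h1 x) ^+ 2).
    by move=> x; rewrite /X; der; rewrite /h /h1; ring.
  have d4 : has_deriv (fun x => G x + 2 * e * Y x + e ^+ 2 * Gh x)
      (fun x => (f x + e * h x) ^+ 2).
    by move=> x; der; rewrite /h; ring.
  move=> /(_ p1 d1 d2 _ d3 d4); rewrite Fh Fl => /(_ erefl).
  by rewrite /X -/W (per _ pf1) (per _ ph) => ineq; lra.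
have hz x : h x * h x = 0.
  apply: (@periodic_null_integral Gh (fun x => h x * h x) ell) => //.
  - by move=> y; rewrite ph.
  - by move=> y; rewrite -expr2 sqr_ge0.
  - apply/eqP; rewrite -subr_eq0 eq_le N0 subr_ge0.
    apply: (has_deriv_le (ltW l0) dGh) => y _.
    by rewrite -expr2 sqr_ge0.
move=> x; have /eqP := hz x; rewrite mulf_eq0 orbb /h => /eqP; rewrite mulNr; lra.
Qed.
End wirtinger.

(** * Euclidean geometry of R^3 *)

Lemma ord3_ind (P : 'I_3 -> Prop) : P 0 -> P 1 -> P 2 -> forall i, P i.
Proof.
move=> p0 p1 p2 [[|[|[|//]]] h]; [move: p0|move: p1|move: p2];
by congr P; apply: val_inj.
Qed.

Section vectors.
Context {R : realType}.
Implicit Types (u v w x y : 'rV[R]_3) (a b : R).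

Lemma dotE u v : dot u v = u 0 0 * v 0 0 + u 0 1 * v 0 1 + u 0 2 * v 0 2.
Proof.
rewrite /dot !big_ord_recr big_ord0 /= add0r.
by congr (_ * _ + _ * _ + _ * _); congr (_ 0 _); apply: val_inj.
Qed.

Lemma crossE u v : [/\ cross u v 0 0 = u 0 1 * v 0 2 - u 0 2 * v 0 1,
  cross u v 0 1 = u 0 2 * v 0 0 - u 0 0 * v 0 2 &
  cross u v 0 2 = u 0 0 * v 0 1 - u 0 1 * v 0 0].
Proof.
rewrite /cross; split; rewrite mxE;
  by congr (_ * _ - _ * _); congr (_ 0 _); apply: val_inj.
Qed.

Lemma dotC u v : dot u v = dot v u.
Proof. by rewrite !dotE; ring. Qed.

Lemma dotDl u v w : dot (u + v) w = dot u w + dot v w.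
Proof. by rewrite !dotE !mxE; ring. Qed.

Lemma dotZl a u v : dot (a *: u) v = a * dot u v.
Proof. by rewrite !dotE !mxE; ring. Qed.

Lemma dotNl u v : dot (- u) v = - dot u v.
Proof. by rewrite !dotE !mxE; ring. Qed.

Lemma dotDr u v w : dot w (u + v) = dot w u + dot w v.
Proof. by rewrite dotC dotDl !(dotC w). Qed.

Lemma dotZr a u v : dot u (a *: v) = a * dot u v.
Proof. by rewrite dotC dotZl dotC. Qed.

Lemma dotNr u v : dot u (- v) = - dot u v.
Proof. by rewrite dotC dotNl dotC. Qed.

Lemma dot0l u : dot 0 u = 0.
Proof. by rewrite -(scale0r 0) dotZl mul0r. Qed.

Definition dot_lin := (dotDl, dotDr, dotNl, dotNr, dotZl, dotZr).

Lemma dot_ge0 u : 0 <= dot u u.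
Proof. by apply: sumr_ge0 => i _; rewrite -expr2 sqr_ge0. Qed.

Lemma dot_eq0 u : dot u u = 0 -> u = 0.
Proof.
move=> /eqP; rewrite /dot psumr_eq0 => [/allP h|i _]; last by rewrite -expr2 sqr_ge0.
apply/rowP => i; rewrite mxE; apply/eqP.
by have := h i; rewrite mem_index_enum mulf_eq0 orbb; apply.
Qed.

Lemma enorm1 u : enorm u = 1 <-> dot u u = 1.
Proof.
rewrite /enorm; split => [h|->]; last exact: sqrtr1.
by rewrite -[LHS]sqr_sqrtr ?dot_ge0// h expr1n.
Qed.

Lemma gram_det u v w : dot (cross u v) w ^+ 2 =
  dot u u * dot v v * dot w w + 2 * dot u v * dot v w * dot u w
  - dot u u * dot v w ^+ 2 - dot v v * dot u w ^+ 2 - dot w w * dot u v ^+ 2.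
Proof. by have [c0 c1 c2] := crossE u v; rewrite !dotE c0 c1 c2; ring. Qed.

Lemma cross_orthol u v : dot (cross u v) u = 0.
Proof. by have [c0 c1 c2] := crossE u v; rewrite !dotE c0 c1 c2; ring. Qed.

Lemma cross_orthor u v : dot (cross u v) v = 0.
Proof. by have [c0 c1 c2] := crossE u v; rewrite !dotE c0 c1 c2; ring. Qed.

Lemma cross_norm u v : dot (cross u v) (cross u v) = dot u u * dot v v - dot u v ^+ 2.
Proof. by have [c0 c1 c2] := crossE u v; rewrite !dotE c0 c1 c2; ring. Qed.

Definition orthonormal u v w :=
  [/\ dot u u = 1, dot v v = 1 & dot w w = 1] /\ [/\ dot u v = 0, dot u w = 0 & dot v w = 0].

(** The matrix with rows [u], [v], [w] has its transpose as right inverse, hence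
    also as left inverse. *)
Lemma orthonormal_expand u v w x : orthonormal u v w ->
  x = dot x u *: u + dot x v *: v + dot x w *: w.
Proof.
move=> [[uu vv ww] [uv uw vw]].
pose M : 'M[R]_3 := \matrix_(i < 3) (if i == 0 then u else if i == 1 then v else w).
have M0 j : M 0 j = u 0 j by rewrite mxE.
have M1 j : M 1 j = v 0 j by rewrite mxE.
have M2 j : M 2 j = w 0 j by rewrite mxE.
have sum3 (f : 'I_3 -> R) : \sum_i f i = f 0 + f 1 + f 2.
  rewrite !big_ord_recr big_ord0 /= add0r.
  by congr (f _ + f _ + f _); apply: val_inj.
have r0 : row 0 M = u by apply/rowP => k; rewrite mxE M0.
have r1 : row 1 M = v by apply/rowP => k; rewrite mxE M1.
have r2 : row 2 M = w by apply/rowP => k; rewrite mxE M2.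
have MM : M *m M^T = 1%:M.
  apply/matrixP => i j; rewrite !mxE.
  rewrite (eq_bigr (fun k => M i k * M j k)); last by move=> k _; rewrite [M^T k j]mxE.
  have MD p q : \sum_k M p k * M q k = dot (row p M) (row q M).
    by apply: eq_bigr => k _; rewrite !mxE.
  by move: i j; apply: ord3_ind; apply: ord3_ind; rewrite MD ?r0 ?r1 ?r2 ?uu ?vv ?ww
     ?uv ?uw ?vw // dotC ?uv ?uw ?vw.
have := mulmx1C MM => MtM.
rewrite -[LHS]mulmx1 -MtM mulmxA.
have MT k : (x *m M^T) 0 k = dot x (row k M).
  by rewrite mxE; apply: eq_bigr => l _; rewrite !mxE.
by apply/rowP => j; rewrite mxE sum3 M0 M1 M2 !MT r0 r1 r2 !mxE.
Qed.

Lemma dot_le1 u v : dot u u = 1 -> dot v v = 1 -> -1 <= dot u v <= 1.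
Proof.
move=> uu vv; have := dot_ge0 (u + v); have := dot_ge0 (u - v).
by rewrite !dot_lin uu vv (dotC v u) => h1 h2; apply/andP; split; lra.
Qed.

End vectors.

Section vector_derivative.
Context {R : realType}.
Implicit Types (u v : R -> 'rV[R]_3).

Definition vderiv u u' := forall i, has_deriv (fun s => u s 0 i) (fun s => u' s 0 i).

Lemma vderiv_dot u u' v v' : vderiv u u' -> vderiv v v' ->
  has_deriv (fun s => dot (u s) (v s)) (fun s => dot (u s) (v' s) + dot (u' s) (v s)).
Proof.
move=> du dv; rewrite (_ : (fun s => dot (u s) (v s)) = fun s =>
  u s 0 0 * v s 0 0 + u s 0 1 * v s 0 1 + u s 0 2 * v s 0 2); last first.
  by apply/funext => s; rewrite dotE.
move=> s; have d0 := du 0; have d1 := du 1; have d2 := du 2.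
have e0 := dv 0; have e1 := dv 1; have e2 := dv 2.
by der; rewrite !dotE; ring.
Qed.

Lemma vderiv_cst w : vderiv (fun=> w) (fun=> 0).
Proof. by move=> i s; der; rewrite mxE. Qed.

Lemma dot_cst_deriv u u' v v' c : vderiv u u' -> vderiv v v' ->
  (forall s, dot (u s) (v s) = c) -> forall s, dot (u s) (v' s) + dot (u' s) (v s) = 0.
Proof.
move=> du dv uvc s; have [_ <-] := vderiv_dot du dv s.
by rewrite (funext uvc : (fun s => dot (u s) (v s)) = cst c) derive_cst.
Qed.

Lemma vderiv_derive1n (G : R -> 'rV[R]_3) k : C4 G -> (k < 4)%N ->
  vderiv (derive1n k G) (derive1n k.+1 G).
Proof.
move=> [dG _] k4 i s.
have d := dG k k4 s.
apply: DeriveDef; first by have /derivable_mxP := d; exact.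
by rewrite derive1nS derive1E derive_mx// mxE.
Qed.

Lemma continuous_coord (u : R -> 'rV[R]_3) i : continuous u -> continuous (fun s => u s 0 i).
Proof.
move=> cu s; apply: (@continuous_comp _ _ _ u (fun M : 'rV[R]_3 => M 0 i)); first exact: cu.
exact: coord_continuous.
Qed.
End vector_derivative.

Section trig.
Context {R : realType}.
Implicit Types (a b w s x : R).

Lemma angle_exists a b : a ^+ 2 + b ^+ 2 = 1 -> exists t, cos t = a /\ sin t = b.
Proof.
move=> ab.
have a1 : -1 <= a <= 1.
  rewrite -ler_norml -(@ler_pXn2r _ 2)// ?nnegrE// real_normK ?num_real// expr1n.
  by have := sqr_ge0 b; lra.
have ca : cos (acos a) = a by apply: acosK; rewrite in_itv.
have sa : sin (acos a) = `|b|.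
  by rewrite sin_acos// (_ : 1 - a ^+ 2 = b ^+ 2) ?sqrtr_sqr//; lra.
have [b0|b0] := leP 0 b; first by exists (acos a); rewrite sa ger0_norm.
by exists (- acos a); rewrite cosN sinN sa ltr0_norm// opprK.
Qed.

Lemma harmonic (f f1 : R -> R) w s : 0 < w -> has_deriv f f1 ->
  has_deriv f1 (fun x => - w ^+ 2 * f x) ->
  f s = f 0 * cos (w * s) + f1 0 / w * sin (w * s) /\
  f1 s = f1 0 * cos (w * s) - w * f 0 * sin (w * s).
Proof.
move=> w0 df df1; have wn : w != 0 by rewrite gt_eqF.
have := @linear_ode_zero R (fun=> - w ^+ 2)
  (fun x => f x - (f 0 * cos (w * x) + f1 0 / w * sin (w * x)))
  (fun x => f1 x - (f1 0 * cos (w * x) - w * f 0 * sin (w * x))) `|- w ^+ 2| s.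
have d1 : has_deriv (fun x => f x - (f 0 * cos (w * x) + f1 0 / w * sin (w * x)))
   (fun x => f1 x - (f1 0 * cos (w * x) - w * f 0 * sin (w * x))).
  by move=> x; der; field.
have d2 : has_deriv (fun x => f1 x - (f1 0 * cos (w * x) - w * f 0 * sin (w * x)))
   (fun x => - w ^+ 2 * (f x - (f 0 * cos (w * x) + f1 0 / w * sin (w * x)))).
  by move=> x; der; field.
move=> /(_ d1 d2 (fun=> lexx _)); rewrite mulr0 cos0 sin0 => h.
by have [||h1 h2] := h; [ring|ring|split; lra].
Qed.

Lemma cos_eq1_lt x : 0 < x < 2 * pi -> cos x != 1.
Proof.
move=> /andP[x0 x1]; apply/eqP => cx.
have : 0 < sin (x / 2) by apply: sin_gt0_pi; apply/andP; split; lra.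
have x2 : x / 2 *+ 2 = x by rewrite mulr2n; lra.
have := cos_mulr2n (x / 2); rewrite x2 cx cos2sin2 mulr2n => h h2.
by have : 0 < sin (x / 2) ^+ 2; [rewrite exprn_gt0|lra].
Qed.
End trig.

(** * Total curvature of closed curves on the sphere *)

Local Opaque dot cross.

Section sphere_curve.
Context {R : realType}.
Variables (ell : R) (G T A J U : R -> 'rV[R]_3).
Hypotheses (ell0 : 0 < ell) (pG : periodic G ell).
Hypotheses (dG : vderiv G T) (dT : vderiv T A) (dA : vderiv A J) (dJ : vderiv J U).
Hypotheses (cU : continuous U).
Hypotheses (G1 : forall s, dot (G s) (G s) = 1) (T1 : forall s, dot (T s) (T s) = 1).

Lemma dot_curve_tangent s : dot (G s) (T s) = 0.
Proof. by have := dot_cst_deriv dG dG G1 s; rewrite (dotC (T s)); lra. Qed.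

Lemma dot_tangent_accel s : dot (T s) (A s) = 0.
Proof. by have := dot_cst_deriv dT dT T1 s; rewrite (dotC (A s)); lra. Qed.

Lemma dot_curve_accel s : dot (G s) (A s) = -1.
Proof. by have := dot_cst_deriv dG dT dot_curve_tangent s; rewrite T1; lra. Qed.

Lemma curvature_sqr s : dot (cross (G s) (A s)) (T s) ^+ 2 = dot (A s) (A s) - 1.
Proof.
rewrite gram_det G1 T1 dot_curve_accel dot_curve_tangent (dotC (A s) (T s)).
by rewrite dot_tangent_accel; ring.
Qed.

Lemma vderiv_periodic u u' : periodic u ell -> vderiv u u' -> periodic u' ell.
Proof.
move=> pu du s; apply/rowP => i.
have pui : periodic (fun t => u t 0 i) ell by move=> t; rewrite pu.
exact: (periodic_deriv pui (du i) s).
Qed.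

Let pT : periodic T ell := vderiv_periodic pG dG.
Let pA : periodic A ell := vderiv_periodic pT dT.

Lemma curvature_continuous : continuous (fun s => dot (cross (G s) (A s)) (T s) ^+ 2 / 4).
Proof.
rewrite (_ : (fun s => _) = fun s => (dot (A s) (A s) - 1) / 4); last first.
  by apply/funext => s; rewrite curvature_sqr.
apply: (@has_deriv_cont _ _ (fun s => (dot (A s) (J s) + dot (J s) (A s)) / 4)) => s.
by have d := vderiv_dot dA dA; der; ring.
Qed.

Lemma curvature_periodic : periodic (fun s => dot (cross (G s) (A s)) (T s) ^+ 2 / 4) ell.
Proof. by move=> s; rewrite pG pA pT. Qed.

Section total_curvature.
Variables (B : R -> R).
Hypothesis dB : has_deriv B (fun s => dot (cross (G s) (A s)) (T s) ^+ 2 / 4).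
Let W := (2 * pi / ell) ^+ 2.

Let cT i : continuous (fun s => T s 0 i). Proof. exact: has_deriv_cont (dT i). Qed.
Let cA i : continuous (fun s => A s 0 i). Proof. exact: has_deriv_cont (dA i). Qed.
Let csq (f : R -> R) : continuous f -> continuous (fun s => f s ^+ 2).
Proof. by move=> cf x; exact: (cvgM (cf x) (cf x)). Qed.
Let P i := sval (cid2 (primitive_exists (csq (@cA i)))).
Let Q i := sval (cid2 (primitive_exists (csq (@cT i)))).
Let dP i : has_deriv (P i) (fun s => A s 0 i ^+ 2).
Proof. by rewrite /P; case: cid2. Qed.
Let dQ i : has_deriv (Q i) (fun s => T s 0 i ^+ 2).
Proof. by rewrite /Q; case: cid2. Qed.

Let pTi i : periodic (fun s => T s 0 i) ell. Proof. by move=> s; rewrite pT. Qed.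
Let Gi i : G ell 0 i = G 0 0 i. Proof. by rewrite -[ell]add0r pG. Qed.

Let wirt i : W * (Q i ell - Q i 0) <= P i ell - P i 0.
Proof. exact: (wirtinger ell0 (@pTi i) (dT i) (dG i) (Gi i) (dP i) (dQ i)). Qed.

Let sumQ : (Q 0 ell - Q 0 0) + (Q 1 ell - Q 1 0) + (Q 2 ell - Q 2 0) = ell.
Proof.
have e : has_deriv (fun s => Q 0 s + Q 1 s + Q 2 s) (fun s => 1).
  move=> s; have d0 := dQ 0; have d1 := dQ 1; have d2 := dQ 2.
  by der; rewrite -(T1 s) dotE !expr2.
have e2 : has_deriv (fun s : R => s) (fun s => 1) by move=> s; der.
by have := has_deriv_unique 0 ell e e2; lra.
Qed.

Let sumP : (P 0 ell - P 0 0) + (P 1 ell - P 1 0) + (P 2 ell - P 2 0) =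
  ell + 4 * (B ell - B 0).
Proof.
have e : has_deriv (fun s => P 0 s + P 1 s + P 2 s) (fun s => dot (A s) (A s)).
  move=> s; have d0 := dP 0; have d1 := dP 1; have d2 := dP 2.
  by der; rewrite dotE !expr2.
have e2 : has_deriv (fun s : R => s + 4 * B s) (fun s => dot (A s) (A s)).
  by move=> s; der; rewrite curvature_sqr; field.
by have := has_deriv_unique 0 ell e e2; lra.
Qed.

(** Wirtinger's inequality for the three coordinates of the tangent: their
    squares sum to 1, and the squares of their derivatives to [1 + kappa^2]. *)
Lemma total_curvature_ge : (W - 1) * ell <= 4 * (B ell - B 0).
Proof.
have := wirt 0; have := wirt 1; have := wirt 2.
by have := sumQ; have := sumP; nra.
Qed.

(** Equality holds in each coordinate, so [J = - W T] and [A + W G] has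
    derivative 0. *)
Lemma total_curvature_eq : (W - 1) * ell = 4 * (B ell - B 0) ->
  forall s, A s + W *: G s = A 0 + W *: G 0.
Proof.
move=> eq s.
have JT i x : J x 0 i = - W * T x 0 i.
  have eqi : P i ell - P i 0 = W * (Q i ell - Q i 0).
    have h0 := wirt 0; have h1 := wirt 1; have h2 := wirt 2; have hP := sumP.
    have hQ : W * (Q 0 ell - Q 0 0 + (Q 1 ell - Q 1 0) + (Q 2 ell - Q 2 0)) = W * ell.
      by rewrite sumQ.
    by move: i; apply: ord3_ind; lra.
  have cJ4 : continuous (fun s => U s 0 i) by exact: continuous_coord.
  by rewrite (wirtinger_eq ell0 (@pTi i) (dT i) (dA i) (dJ i) cJ4 (dG i) (Gi i)
    (dP i) (dQ i) eqi).
apply/rowP => i.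
apply: (@has_deriv0_cst R (fun s => (A s + W *: G s) 0 i) (fun s => J s 0 i + W * T s 0 i)).
  rewrite (_ : (fun s => _) = fun s => A s 0 i + W * G s 0 i); last first.
    by apply/funext => t; rewrite !mxE.
  by move=> t; have dAi := dA i; have dGi := dG i; der; ring.
by move=> t; rewrite JT; ring.
Qed.
End total_curvature.
End sphere_curve.

(** * Curves that are circles *)

Section circles.
Context {R : realType}.
Implicit Types (v x : 'rV[R]_3) (h r w : R).

Lemma circle_range v b1 b2 h r w (G : R -> 'rV[R]_3) : orthonormal v b1 b2 ->
  0 < r -> 0 < w -> h ^+ 2 + r ^+ 2 = 1 ->
  (forall s, G s = h *: v + (r * cos (w * s)) *: b1 + (r * sin (w * s)) *: b2) ->
  range G = [set x | dot x x = 1 /\ dot v x = h].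
Proof.
move=> on r0 w0 hr Gs; have [[vv b11 b22] [vb1 vb2 b12]] := on.
have rn : r != 0 by rewrite gt_eqF.
apply/seteqP; split => [_ [s _ <-]|x [xx vx]] /=.
  rewrite Gs !dot_lin vv vb1 vb2 b11 b22 (dotC b1 v) (dotC b2 v) (dotC b2 b1) vb1 vb2 b12.
  have cs : r ^+ 2 * (cos (w * s) ^+ 2 + sin (w * s) ^+ 2) = r ^+ 2.
    by rewrite cos2Dsin2 mulr1.
  by split; lra.
have ex := orthonormal_expand x on.
have xn : dot x v ^+ 2 + dot x b1 ^+ 2 + dot x b2 ^+ 2 = 1.
  by rewrite -xx {5}ex !dot_lin; ring.
have [|t [ct st]] := @angle_exists R (dot x b1 / r) (dot x b2 / r).
  rewrite !expr_div_n -mulrDl (_ : _ + _ = r ^+ 2) ?divff ?expf_neq0//.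
  by rewrite (dotC x v) vx in xn; lra.
exists (t / w) => //.
rewrite Gs [w * _]mulrC divfK ?gt_eqF// ct st.
by rewrite ![r * _]mulrC !divfK// -vx (dotC v) -ex.
Qed.

End circles.

Section curve_shape.
Context {R : realType}.
Variables (ell : R) (G T A : R -> 'rV[R]_3).
Hypotheses (ell0 : 0 < ell) (pG : periodic G ell).
Hypotheses (dG : vderiv G T) (dT : vderiv T A).
Hypotheses (G1 : forall s, dot (G s) (G s) = 1) (T1 : forall s, dot (T s) (T s) = 1).

Let GT s : dot (G s) (T s) = 0 := dot_curve_tangent dG G1 s.
Let TA s : dot (T s) (A s) = 0 := dot_tangent_accel dT T1 s.
Let GA s : dot (G s) (A s) = -1 := dot_curve_accel dG dT G1 T1 s.

Lemma harmonic_curve w (c : 'rV[R]_3) s : 0 < w ->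
  (forall s, A s = - w ^+ 2 *: (G s - c)) ->
  G s = c + cos (w * s) *: (G 0 - c) + (w^-1 * sin (w * s)) *: T 0 /\
  T s = cos (w * s) *: T 0 - (w * sin (w * s)) *: (G 0 - c).
Proof.
move=> w0 Gw.
have coord i : G s 0 i = c 0 i + cos (w * s) * (G 0 0 i - c 0 i) + w^-1 * sin (w * s) * T 0 0 i
  /\ T s 0 i = cos (w * s) * T 0 0 i - w * sin (w * s) * (G 0 0 i - c 0 i).
  have dGi := dG i; have dTi := dT i.
  have d1 : has_deriv (fun x => G x 0 i - c 0 i) (fun x => T x 0 i).
    by move=> x; der; ring.
  have d2 : has_deriv (fun x => T x 0 i) (fun x => - w ^+ 2 * (G x 0 i - c 0 i)).
    by move=> x; have := dTi x; rewrite Gw !mxE.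
  have [h1 h2] := harmonic s w0 d1 d2.
  by split; [lra|rewrite h2; ring].
by split; apply/rowP => i; have [h1 h2] := coord i; rewrite !mxE; [exact: h1|exact: h2].
Qed.

(** The center [c] of the circle has squared length [1 - w^-2]. As it may be 0,
    the axis [v] is taken as the cross product of two orthogonal directions in
    the plane of the circle. *)
Lemma curve_is_circle :
  (forall s, A s + (2 * pi / ell) ^+ 2 *: G s =
             A 0 + (2 * pi / ell) ^+ 2 *: G 0) ->
  exists v h, [/\ dot v v = 1, h ^+ 2 = 1 - (2 * pi / ell) ^- 2 &
    range G = [set x | dot x x = 1 /\ dot v x = h]].
Proof.
move=> Ad; set w := 2 * pi / ell in Ad *.
have w0 : 0 < w by rewrite divr_gt0// mulr_gt0// pi_gt0.
have wn : w != 0 by rewrite gt_eqF.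
(* d / w^2 is the center of the circle *)
have [d {}Ad] : exists d, forall s, A s + w ^+ 2 *: G s = d by eexists; exact: Ad.
pose c := w ^- 2 *: d; pose H := 1 - w ^- 2.
have dGw s : dot d (G s) = w ^+ 2 - 1.
  by rewrite -(Ad s) !dot_lin G1 (dotC (A s)) GA; ring.
have dT0 s : dot d (T s) = 0.
  have := dot_cst_deriv (vderiv_cst d) dG dGw s.
  by rewrite dot0l addr0.
have dA0 s : dot d (A s) = 0.
  have := dot_cst_deriv (vderiv_cst d) dT dT0 s.
  by rewrite dot0l addr0.
have dd : dot d d = w ^+ 2 * (w ^+ 2 - 1).
  by rewrite -{2}(Ad 0) !dot_lin dA0 dGw; ring.
have cG0 : dot c (G 0) = H by rewrite dotZl dGw /H; field.
have cT0 : dot c (T 0) = 0 by rewrite dotZl dT0 mulr0.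
have cc : dot c c = H by rewrite dotZl dotZr dd /H; field.
have Aw s : A s = - w ^+ 2 *: (G s - c).
  rewrite scalerBr !scaleNr opprK /c scalerA mulfV ?expf_neq0// scale1r -(Ad s) addrC.
  by rewrite addrK.
clearbody c.
pose b1 := w *: (G 0 - c); pose b2 := T 0; pose v := cross b1 b2.
have b11 : dot b1 b1 = 1.
  by rewrite /b1 !dot_lin G1 (dotC (G 0) c) cG0 cc /H; field.
have b22 : dot b2 b2 = 1 by exact: T1.
have b12 : dot b1 b2 = 0 by rewrite /b1 /b2 !dot_lin GT cT0; ring.
have on : orthonormal v b1 b2.
  split; split => //; last first.
  - exact: cross_orthor.
  - exact: cross_orthol.
  - by rewrite cross_norm b11 b22 b12; ring.
have cv : c = dot c v *: v.
  rewrite [LHS](orthonormal_expand c on).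
  have -> : dot c b1 = 0 by rewrite /b1 !dot_lin cG0 cc; ring.
  by rewrite cT0 !scale0r !addr0.
have hH : dot c v ^+ 2 = 1 - w ^- 2.
  have [[vv _ _] _] := on.
  by rewrite -/H -cc [in RHS]cv !dot_lin vv; ring.
exists v, (dot c v); split => //; first by have [[]] := on.
apply: (@circle_range _ v b1 b2 (dot c v) w^-1 w) => //.
- by rewrite invr_gt0.
- by rewrite hH exprVn; ring.
move=> s; have [-> _] := harmonic_curve s w0 Aw; rewrite -cv.
by rewrite /b1 scalerA [X in X *: (G 0 - c)]mulrC mulrA mulfV ?mul1r.
Qed.

(** In the frame formed by [v], the direction from the axis and the tangent,
    only the second component of the acceleration is nonzero, and it equals
    minus the inverse of [r]. *)
Lemma latitude_curve v h r : dot v v = 1 -> 0 < r -> h ^+ 2 + r ^+ 2 = 1 ->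
  (forall s, dot v (G s) = h) -> {in `[0, ell[ &, injective G} ->
  ell = 2 * pi * r /\ forall s, dot (cross (G s) (A s)) (T s) ^+ 2 = (h / r) ^+ 2.
Proof.
move=> vv r0 hr vG injG; have rn : r != 0 by rewrite gt_eqF.
have vT s : dot v (T s) = 0.
  by have := dot_cst_deriv (vderiv_cst v) dG vG s; rewrite dot0l addr0.
have vA s : dot v (A s) = 0.
  by have := dot_cst_deriv (vderiv_cst v) dT vT s; rewrite dot0l addr0.
have h2 : h ^+ 2 = 1 - r ^+ 2 by lra.
have Aw s : A s = - r^-1 ^+ 2 *: (G s - h *: v).
  pose b := r^-1 *: (G s - h *: v).
  have on : orthonormal v b (T s).
    split; split => //.
    - by rewrite /b !dot_lin G1 (dotC (G s) v) vG vv; field: h2.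
    - by rewrite /b !dot_lin vG vv; ring.
    - by rewrite /b !dot_lin GT vT; ring.
  rewrite [LHS](orthonormal_expand _ on) !(dotC (A s)) vA TA !scale0r add0r addr0.
  have -> : dot b (A s) = - r^-1 by rewrite /b !dot_lin GA vA; ring.
  by rewrite /b scalerA mulNr expr2.
split; last first.
  move=> s; rewrite (curvature_sqr dG dT G1 T1) Aw !dot_lin G1.
  by rewrite (dotC (G s) v) vG vv expr_div_n; field: h2.
have ri : 0 < r^-1 by rewrite invr_gt0.
have GT_ s := harmonic_curve s ri Aw.
(* injectivity on [0, ell) gives ell <= 2 pi r, and then cos (ell / r) = 1 gives equality *)
have period : G (2 * pi * r) = G 0.
  have [-> _] := GT_ (2 * pi * r); have -> : r^-1 * (2 * pi * r) = pi *+ 2.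
    by rewrite -mulr_natr; field.
  by rewrite cos2pi sin2pi mulr0 scale0r addr0 scale1r addrC subrK.
have p0 : 0 < 2 * pi * r by rewrite !mulr_gt0// pi_gt0.
apply/eqP; rewrite eq_le; apply/andP; split; rewrite leNgt; apply/negP => lt.
  have : 2 * pi * r = 0.
    by apply: injG; rewrite // inE/= in_itv/= ?lexx ?ell0 ?lt ?(ltW p0).
  by move/eqP; rewrite gt_eqF.
have [_ e] := GT_ ell.
have Tl : T ell = T 0.
  by have /(_ 0) := vderiv_periodic pG dG; rewrite add0r.
have : dot (T ell) (T 0) = cos (r^-1 * ell).
  rewrite [T ell]e !dot_lin GT vT T1; ring.
rewrite Tl T1 => ec.
have : cos (r^-1 * ell) != 1.
  by apply: cos_eq1_lt; rewrite mulr_gt0//= mulrC ltr_pdivrMr.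
by rewrite -ec eqxx.
Qed.
End curve_shape.

(** * The eigenspaces *)

Local Open Scope complex_scope.
Local Open Scope ring_scope.
Local Open Scope classical_set_scope.

Section sobolev.
Context {R : realType}.
Notation mu := (@lebesgue_measure R).
Implicit Types (f g q : R -> R) (ell k p m : R).

Lemma H2_deriv2_smooth ell f f1 g : periodic f ell -> has_deriv f f1 ->
  has_deriv f1 g -> continuous g -> H2_deriv2 ell f g.
Proof.
move=> pf df df1 cg; split => //.
- by move=> s; have [] := df s.
- by apply: measurable_funTS; exact: continuous_measurable_fun.
- have cg2 : continuous (fun s => g s ^+ 2) by move=> x; exact: (cvgM (cg x) (cg x)).
  have /integrableP[_] := cont_integrable 0 ell cg2.
  apply: le_lt_trans; rewrite le_eqVlt; apply/orP; left; apply/eqP.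
  by apply: eq_integral => x _ /=; rewrite ger0_norm// sqr_ge0.
- move=> t /andP[t0 _]; rewrite (Rintegral_deriv cg df1 t0) !derive1E.
  by have [_ ->] := df t; have [_ ->] := df 0; lra.
Qed.

(** The second derivative is known almost everywhere only, but [f'] is its
    integral, hence the integral of the continuous function [- p f]. *)
Lemma weak_solution_smooth ell f g p : 0 < ell -> H2_deriv2 ell f g ->
  {ae mu, forall s, 0 <= s <= ell -> g s = - p * f s} ->
  has_deriv f (derive1 f) /\ has_deriv (derive1 f) (fun x => - p * f x).
Proof.
move=> l0 [pf drf mg _ fg] gf.
have df : has_deriv f (derive1 f) by move=> x; apply: DeriveDef => //; rewrite derive1E.
have cf := has_deriv_cont df.
have cpf : continuous (fun x => - p * f x).
  by move=> x; apply: cvgM; [exact: cvg_cst|exact: cf].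
have [F dF F0] := primitive_exists cpf.
have int t : 0 <= t <= ell -> \int[mu]_(s in `[0, t]) g s = F t.
  move=> /andP[t0 tl].
  have -> : F t = F t - F 0 by rewrite F0 subr0.
  rewrite -(Rintegral_deriv cpf dF t0) /Rintegral; congr fine.
  have sub : `[0, t] `<=` `[0, ell]%classic.
    by apply: subset_itvl; rewrite bnd_simp.
  apply: ae_eq_integral => //.
  - apply/measurable_EFinP; apply: measurable_funS mg => //.
  - by apply/measurable_EFinP; apply: measurable_funTS; exact: continuous_measurable_fun.
  - apply: (@filterS _ _ (ae_filter_ringOfSetsType mu) _ _ _ gf) => x gx /= /sub.
    rewrite /= in_itv/= => xl.
    by rewrite gx.
(* the equation for f' is given on one period only, and extends by periodicity *)
have pD : periodic (fun x => derive1 f x - F x) ell.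
  have pf1 := periodic_deriv pf df.
  move=> x; rewrite pf1; congr (_ - _).
  have pg : periodic (fun x => - p * f x) ell by move=> y; rewrite pf.
  have := periodic_primitive_shift x pg dF.
  have := fg ell; rewrite int ?lexx ?ltW// => /(_ isT).
  by rewrite -{1}[ell]add0r pf1 F0; lra.
split => // x.
have -> : derive1 f = fun y => derive1 f 0 + F y.
  apply/funext => y; have [z /andP[z0 zl] e] := periodic_rep y l0 pD.
  by have := fg z; rewrite int z0 ?ltW// => /(_ isT); move: e => /=; lra.
by der; ring.
Qed.

(** For [p != 0] the equation forces zero mean, and integration by parts makes
    the integral of [f1^2] equal to [p] times that of [f^2], below the Wirtinger
    bound unless [f = 0]. *)
Lemma periodic_solution ell f f1 p : 0 < ell -> periodic f ell -> has_deriv f f1 ->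
  has_deriv f1 (fun x => - p * f x) -> p < (2 * pi / ell) ^+ 2 ->
  (p = 0 -> forall x, f x = f 0) /\ (p != 0 -> forall x, f x = 0).
Proof.
move=> l0 pf df df1 pW.
have pf1 := periodic_deriv pf df.
have f1l : f1 ell = f1 0 by rewrite -[ell]add0r pf1.
have fl : f ell = f 0 by rewrite -[ell]add0r pf.
have cf := has_deriv_cont df; have cf1 := has_deriv_cont df1.
split=> [p0 x|pn0 x].
  have f1c y z : f1 y = f1 z.
    by apply: (has_deriv0_cst _ _ df1) => t; rewrite p0 oppr0 mul0r.
  have [c _] := is_derive_MVT (ltW l0) (fun x _ => df x).
  rewrite fl subrr subr0 => /esym/eqP; rewrite mulf_eq0 (gt_eqF l0) orbF => /eqP f1c0.
  by apply: (has_deriv0_cst _ _ df) => t; rewrite (f1c t c).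
have [F dF _] := primitive_exists cf.
have Fl : F ell = F 0.
  have d : has_deriv (fun x => f1 x + p * F x) (fun=> 0) by move=> y; der; ring.
  have := has_deriv0_cst 0 ell d (fun=> erefl).
  by rewrite f1l => /addrI/(mulfI pn0).
have csq (h : R -> R) : continuous h -> continuous (fun x : R => h x ^+ 2 : R).
  by move=> ch y; exact: (cvgM (ch y) (ch y)).
have [P dP _] := primitive_exists (csq _ cf1).
have [G dG _] := primitive_exists (csq _ cf).
have W := wirtinger l0 pf df dF Fl dP dG.
have PG : P ell - P 0 = p * (G ell - G 0).
  have d : has_deriv (fun x => P x - p * G x - f x * f1 x) (fun=> 0).
    by move=> y; der; rewrite /=; ring.
  have := has_deriv0_cst 0 ell d (fun=> erefl).
  by rewrite f1l fl; lra.
have G0 : G 0 <= G ell.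
  by apply: (has_deriv_le (ltW l0) dG) => t _; rewrite sqr_ge0.
have Gl : G ell = G 0.
  by apply/eqP; rewrite eq_le G0 andbT; rewrite PG in W; nra.
have pff : periodic (fun x => f x ^+ 2) ell by move=> y; rewrite pf.
apply/eqP; rewrite -sqrf_eq0; apply/eqP.
by apply: (periodic_null_integral l0 pff dG _ Gl) => y; exact: sqr_ge0.
Qed.
End sobolev.

Section spectrum.
Context {R : realType}.
Implicit Types (ell k m : R) (kap : R -> R) (V : set (R -> R[i])).

Lemma ReMC (a : R) (z : R[i]) : complex.Re (a%:C * z) = a * complex.Re z.
Proof. by case: z => x y /=; rewrite mul0r subr0. Qed.

Lemma ImMC (a : R) (z : R[i]) : complex.Im (a%:C * z) = a * complex.Im z.
Proof. by case: z => x y /=; rewrite mul0r addr0. Qed.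

Lemma ReB (z w : R[i]) : complex.Re (- z - w) = - complex.Re z - complex.Re w.
Proof. by case: z w => [? ?] [? ?]. Qed.

Lemma ImB (z w : R[i]) : complex.Im (- z - w) = - complex.Im z - complex.Im w.
Proof. by case: z w => [? ?] [? ?]. Qed.

Lemma eigenspace_real ell kap m (u v : R -> R) : periodic u ell -> has_deriv u v ->
  has_deriv v (fun x => (m - kap x ^+ 2 / 4) * u x) ->
  continuous (fun x => kap x ^+ 2 / 4) ->
  eigenspace_K ell kap (- m) (fun s => (u s)%:C).
Proof.
move=> pu du dv cq; exists (fun s => ((m - kap s ^+ 2 / 4) * u s)%:C); split.
- apply: (H2_deriv2_smooth pu du dv) => x; apply: cvgM; last exact: has_deriv_cont du x.
  by apply: cvgB; [exact: cvg_cst|exact: cq].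
- have d0 : has_deriv (fun _ : R => 0 : R) (fun=> 0) by move=> x; der.
  by apply: (H2_deriv2_smooth _ d0 d0) => // x; exact: cvg_cst.
- apply: (@filterE _ _ (ae_filter_ringOfSetsType lebesgue_measure)) => s _.
  rewrite -!rmorphM -rmorphN -rmorphB/=.
  by congr (_%:C); ring.
Qed.

Lemma eigenspace_const_potential ell kap k m f : 0 < ell ->
  (forall s, kap s ^+ 2 / 4 = k) -> k + m < (2 * pi / ell) ^+ 2 ->
  eigenspace_K ell kap m f ->
  (k + m = 0 -> f = fun=> f 0) /\ (k + m != 0 -> f = fun=> 0).
Proof.
move=> l0 kk km [g [fRe fIm fg]].
have aeR : {ae @lebesgue_measure R, forall s, 0 <= s <= ell ->
    complex.Re (g s) = - (k + m) * complex.Re (f s)}.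
  apply: (@filterS _ _ (ae_filter_ringOfSetsType lebesgue_measure) _ _ _ fg) => s h.
  move=> /h /(congr1 (@complex.Re R)).
  by rewrite ReB !ReMC kk; lra.
have aeI : {ae @lebesgue_measure R, forall s, 0 <= s <= ell ->
    complex.Im (g s) = - (k + m) * complex.Im (f s)}.
  apply: (@filterS _ _ (ae_filter_ringOfSetsType lebesgue_measure) _ _ _ fg) => s h.
  move=> /h /(congr1 (@complex.Im R)).
  by rewrite ImB !ImMC kk; lra.
have [dR dR1] := weak_solution_smooth l0 fRe aeR.
have [dI dI1] := weak_solution_smooth l0 fIm aeI.
have [pR _ _ _ _] := fRe; have [pI _ _ _ _] := fIm.
have [R0 Rn0] := periodic_solution l0 pR dR dR1 km.
have [I0 In0] := periodic_solution l0 pI dI dI1 km.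
split=> e; apply/funext => s; apply/eqP; rewrite eq_complex; apply/andP; split; apply/eqP.
- exact: R0.
- exact: I0.
- exact: Rn0.
- exact: In0.
Qed.

Lemma has_dim_gt0 V n f s : has_dim V n -> V f -> f s != 0 -> (0 < n)%N.
Proof.
move=> [e [_ h]] /h[c [fc _]] fs; case: n => // in e h c fc *.
by move: fs; rewrite fc big_ord0 eqxx.
Qed.

Lemma has_dim_zero V n : has_dim V n -> (forall f, V f -> f = fun=> 0) -> n = 0%N.
Proof.
case: n => // n [e [Ve h]] V0; have /h[c [_ uc]] := Ve ord0.
pose a (z : R[i]) : {ffun 'I_n.+1 -> R[i]} := [ffun=> z].
have ea z : e ord0 = fun s => \sum_i a z i * e i s.
  rewrite (V0 _ (Ve ord0)); apply/funext => s.
  by rewrite big1// => i _; rewrite (V0 _ (Ve i)) mulr0.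
have := uc _ (ea 0); rewrite (uc _ (ea 1)) => /ffunP/(_ ord0).
by rewrite !ffunE => /eqP; rewrite oner_eq0.
Qed.

(** Two constants are proportional, so independent ones number at most one. *)
Lemma has_dim_constants V n : has_dim V n -> V (fun=> 1) ->
  (forall f, V f -> f = fun=> f 0) -> n = 1%N.
Proof.
move=> Vn V1 Vc; have n0 := has_dim_gt0 (s := 0) Vn V1 (oner_neq0 _).
case: n Vn n0 => // -[//|n] [e [Ve h]] _; exfalso.
pose i0 : 'I_n.+2 := ord0; pose i1 : 'I_n.+2 := lift ord0 ord0.
have i10 : i1 != i0 by [].
have ec i s : e i s = e i 0 by rewrite (Vc _ (Ve i)).
have inj f (c d : {ffun 'I_n.+2 -> R[i]}) : V f ->
    f = (fun s => \sum_i c i * e i s) -> f = (fun s => \sum_i d i * e i s) -> c = d.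
  by move=> /h[x [_ ux]] fc fd; rewrite -(ux c fc) (ux d fd).
pose delta i : {ffun 'I_n.+2 -> R[i]} := [ffun j => (j == i)%:R].
have sum_delta i : e i = fun s => \sum_j delta i j * e j s.
  apply/funext => s; rewrite (bigD1 i)//= ffunE eqxx mul1r big1 ?addr0// => j ji.
  by rewrite ffunE (negbTE ji) mul0r.
have ei0 i : e i 0 != 0.
  apply/eqP => e0; have := inj _ (delta i) [ffun=> 0] (Ve i) (sum_delta i).
  have -> : e i = fun s => \sum_j [ffun=> 0 : R[i]] j * e j s.
    by apply/funext => s; rewrite ec e0 big1// => j _; rewrite ffunE mul0r.
  by move=> /(_ erefl)/ffunP/(_ i); rewrite !ffunE eqxx => /eqP; rewrite oner_eq0.
pose c := e i0 0 / e i1 0.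
have := inj _ (delta i0) [ffun j => (j == i1)%:R * c] (Ve i0) (sum_delta i0).
have -> : e i0 = fun s => \sum_j [ffun j => (j == i1)%:R * c] j * e j s.
  apply/funext => s; rewrite (bigD1 i1)//= ffunE eqxx mul1r big1 ?addr0 => [|j ji].
    by rewrite !ec /c divfK.
  by rewrite ffunE (negbTE ji) !mul0r.
move=> /(_ erefl)/ffunP/(_ i0).
rewrite !ffunE eqxx [i0 == i1]eq_sym (negbTE i10) mul0r => /eqP.
by rewrite oner_eq0.
Qed.

End spectrum.

(** * Eigenvalues, cones and the bound on k_S *)

Section k_S.
Context {R : realType}.
Implicit Types lam : nat -> R.

Let sqrt_ge0 (x : R) : (0 <= (Num.sqrt x)%:E)%E.
Proof. by rewrite lee_fin sqrtr_ge0. Qed.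

Let twopi_ge0 : 0 <= (2 * pi : R)^-1.
Proof. by rewrite invr_ge0 mulr_ge0// pi_ge0. Qed.

Lemma k_S_esum lam : k_S lam = (((2 * pi)^-1)%:E *
  \esum_(j in [set j | (lam j < 0)%R]) (Num.sqrt (- lam j))%:E)%E.
Proof. by rewrite /k_S nneseries_esum. Qed.

Lemma k_S_ge0 lam : (0 <= k_S lam)%E.
Proof. by rewrite k_S_esum mule_ge0 ?lee_fin// esum_ge0. Qed.

Lemma k_S_single lam j0 : [set j | lam j < 0] = [set j0] ->
  k_S lam = ((2 * pi)^-1 * Num.sqrt (- lam j0))%:E.
Proof. by move=> e; rewrite k_S_esum e esum_set1. Qed.

Lemma k_S_ge lam j0 : lam j0 < 0 ->
  (((2 * pi)^-1 * Num.sqrt (- lam j0))%:E <= k_S lam)%E.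
Proof.
move=> j0lt; rewrite k_S_esum EFinM lee_wpmul2l ?lee_fin//.
apply: esum_ge; exists [set j0]; last by rewrite fsbig_set1.
by split; [exact: finite_set1|move=> _ ->].
Qed.
End k_S.

Section eigenvalues.
Context {R : realType}.
Variables (ell : R) (kap : R -> R) (lam : nat -> R).
Hypotheses (ell0 : 0 < ell) (hlam : eigenvalue_sequence ell kap lam).

Lemma eigenfunction_eigenvalue m f s : eigenspace_K ell kap m f -> f s != 0 ->
  exists j, lam j = m.
Proof.
move=> Vf fs; have [n dn cn] := hlam.2 m.
have n0 := has_dim_gt0 dn Vf fs.
apply: contrapT => nj; move: cn.
have -> : [set j | lam j = m] = set0 by apply/seteqP; split=> j // e; apply: nj; exists j.
by rewrite -II0 => /card_eq_II e; rewrite -e in n0.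
Qed.

(** Below [0] the parameter [k + lam j] stays under the Wirtinger constant, so
    an eigenfunction exists only for [lam j = - k], and is constant. *)
Lemma negative_eigenvalues_const k : 0 < k -> (forall s, kap s ^+ 2 / 4 = k) ->
  k < (2 * pi / ell) ^+ 2 -> exists2 j0, lam j0 = - k & [set j | lam j < 0] = [set j0].
Proof.
move=> k0 kk kW.
have [n dn cn] := hlam.2 (- k).
have n1 : n = 1%N.
  apply: (has_dim_constants dn).
    have -> : (fun=> 1) = (fun s : R => ((cst 1 : R -> R) s)%:C).
      by apply/funext => s; rewrite /= rmorph1.
    have d1 : has_deriv (cst 1 : R -> R) (cst 0) by move=> x; exact: is_derive_cst.
    apply: (eigenspace_real _ d1) => [//|x|].
      by rewrite kk subrr mul0r; exact: is_derive_cst.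
    by rewrite (funext kk) => x; exact: cvg_cst.
  move=> f Vf; have [|h _] := eigenspace_const_potential ell0 kk _ Vf.
    by rewrite subrr; apply: lt_trans kW.
  by apply: h; rewrite subrr.
rewrite n1 in cn; case/eq_cardSP: cn => j0 /= lj0; rewrite II0 card_eq0 => /eqP A0.
exists j0 => //; apply/seteqP; split=> [j /= lj|_ ->] /=; last by rewrite lj0 oppr_lt0.
have [ljk|ljk] := eqVneq (lam j) (- k).
  apply: contrapT => jj0; have : (set0 : set nat) j by rewrite -A0; split.
  by [].
exfalso; have [n' dn' cn'] := hlam.2 (lam j).
have n'0 : n' = 0%N.
  apply: (has_dim_zero dn') => f Vf.
  have [|_ h] := eigenspace_const_potential ell0 kk _ Vf.
    by apply: lt_trans kW; rewrite gtrDl.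
  by apply: h; rewrite addrC addr_eq0.
move: cn'; rewrite n'0 II0 card_eq0 => /eqP e.
have : (set0 : set nat) j by rewrite -e.
by [].
Qed.
End eigenvalues.

Section conical.
Context {R : realType}.
Variable S : set 'rV[R]_3.
Hypothesis hS : conical_surface S.

Lemma conical_scale t x : 0 < t -> S x -> S (t *: x).
Proof. by move=> t0 Sx; rewrite -(hS.2 t t0); exists x. Qed.

Lemma normalize_sphere x : x != 0 ->
  exists t : R, 0 < t /\ dot (t *: x) (t *: x) = 1.
Proof.
move=> x0; have xx : 0 < dot x x.
  by rewrite lt_neqAle dot_ge0 andbT eq_sym; apply/eqP => /dot_eq0/eqP; rewrite (negbTE x0).
exists (Num.sqrt (dot x x))^-1; split; first by rewrite invr_gt0 sqrtr_gt0.
by rewrite dotZl dotZr mulrA -expr2 exprVn sqr_sqrtr ?dot_ge0// mulVf// gt_eqF.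
Qed.

(** A cone is determined by its cross-section up to the vertex. *)
Lemma great_circle_plane v : dot v v = 1 ->
  cross_section S = [set x | dot x x = 1 /\ dot v x = 0] -> is_plane S.
Proof.
move=> vv Sv; exists v; split.
  by apply/eqP => v0; move: vv; rewrite v0 dot0l => /eqP; rewrite eq_sym oner_eq0.
have key x t : 0 < t -> dot (t *: x) (t *: x) = 1 -> S x <-> dot v x = 0.
  move=> t0 tx; split=> [Sx|vx].
    have : cross_section S (t *: x).
      by split; [exact: conical_scale|exact/enorm1].
    rewrite Sv /= => -[_]; rewrite dotZr => /eqP.
    by rewrite mulf_eq0 gt_eqF//= => /eqP.
  have [] : cross_section S (t *: x) by rewrite Sv /= (dotZr t v) vx mulr0.
  move=> Stx _; have -> : x = t^-1 *: (t *: x).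
    by rewrite scalerA mulVf ?gt_eqF// scale1r.
  by apply: conical_scale => //; rewrite invr_gt0.
apply/seteqP; split=> [x [Sx|->]|x /= vx].
- have [->|/normalize_sphere[t [t0 tx]]] := eqVneq x 0; first by rewrite /= dotC dot0l.
  exact/(key x t t0 tx).
- by rewrite /= dotC dot0l.
- have [->|/normalize_sphere[t [t0 tx]]] := eqVneq x 0; first by right.
  by left; exact/(key x t t0 tx).
Qed.

(** Replacing [v] by [- v] makes the height positive, and thus the opening angle
    acute. *)
Lemma small_circle_cone v h : dot v v = 1 -> h != 0 -> h ^+ 2 < 1 ->
  cross_section S = [set x | dot x x = 1 /\ dot v x = h] -> circular_cone S.
Proof.
wlog h0 : v h / 0 < h.
  move=> w vv hn h1 Sv; have [h0|h0] := ltP 0 h; first exact: (w v h).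
  apply: (w (- v) (- h)) => //.
  - by rewrite oppr_gt0 lt_neqAle hn.
  - by rewrite dotNl dotNr opprK.
  - by rewrite oppr_eq0.
  - by rewrite sqrrN.
  - rewrite Sv; apply/seteqP; split=> x /= [xx vx]; split=> //.
      by rewrite dotNl vx.
    by apply: oppr_inj; rewrite -dotNl.
move=> vv hn h1 Sv.
have hlt1 : h < 1 by rewrite -(@ltr_pXn2r _ 2) ?nnegrE// ?expr1n// ltW.
have h11 : -1 <= h <= 1 by apply/andP; split; lra.
exists v, (acos h); split.
- exact/enorm1.
- have ca : cos (acos h) = h by apply: acosK; rewrite in_itv.
  rewrite acos_gt0/=; last by apply/andP; split; lra.
  rewrite ltNge; apply/negP => le.
  have : cos (acos h) <= 0.
    have a1 := acos_lepi h11; have := pi_gt0 R => p0.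
    have e : acos h = (acos h - pi) + pi by ring.
    rewrite e cosDpi oppr_le0; apply: cos_ge0_pihalf; apply/andP; split; lra.
  by rewrite ca leNgt h0.
- rewrite Sv; apply/seteqP; split=> x /= [xx vx]; split.
  + exact/enorm1.
  + by rewrite vx.
  + exact/enorm1.
  + have vx1 := dot_le1 vv ((enorm1 x).1 xx).
    by rewrite -(@acosK R (dot v x)) ?in_itv// vx acosK// in_itv.
Qed.
End conical.

Lemma circular_cone_latitude (R : realType) (S : set 'rV[R]_3) : circular_cone S ->
  exists v h r, [/\ dot v v = 1, 0 < h, 0 < r, h ^+ 2 + r ^+ 2 = 1 &
    forall x, cross_section S x -> dot v x = h].
Proof.
move=> [v [t [/enorm1 vv /andP[t0 t1] Sv]]].
exists v, (cos t), (sin t); split => //.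
- by apply: cos_gt0_pihalf; rewrite t1 andbT (lt_trans _ t0)// oppr_lt0 divr_gt0// pi_gt0.
- by apply: sin_gt0_pihalf; rewrite t0.
- exact: cos2Dsin2.
move=> x; rewrite Sv => -[/enorm1 xx <-].
by rewrite acosK// in_itv; exact: dot_le1.
Qed.

Theorem theorem5 (R : realType) (S : set 'rV[R]_3) (ell : R)
    (Gamma : R -> 'rV[R]_3) (lam : nat -> R)
    (hS : conical_surface S) (hplane : ~ is_plane S)
    (hGamma : arclength_param (cross_section S) ell Gamma)
    (hell : ell <= 2 * pi)
    (hlam : eigenvalue_sequence ell (geodesic_curvature Gamma) lam) :
  ((Num.sqrt (4 * pi ^+ 2 - ell ^+ 2) / (4 * pi * ell))%:E <= k_S lam)%E /\
  (k_S lam = (Num.sqrt (4 * pi ^+ 2 - ell ^+ 2) / (4 * pi * ell))%:E <->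
   circular_cone S).
Proof.
have [[ell0 pG] injG cG rG unit] := hGamma.
have dG : vderiv Gamma (derive1 Gamma) := @vderiv_derive1n _ Gamma 0 cG isT.
have dT : vderiv (derive1 Gamma) (derive1n 2 Gamma) := @vderiv_derive1n _ Gamma 1 cG isT.
have dA : vderiv (derive1n 2 Gamma) (derive1n 3 Gamma) := @vderiv_derive1n _ Gamma 2 cG isT.
have dJ : vderiv (derive1n 3 Gamma) (derive1n 4 Gamma) := @vderiv_derive1n _ Gamma 3 cG isT.
have cU : continuous (derive1n 4 Gamma) := cG.2.
have G1 s : dot (Gamma s) (Gamma s) = 1.
  have : cross_section S (Gamma s) by rewrite -rG; exists s.
  by move=> [_ /enorm1].
have T1 s : dot (derive1 Gamma s) (derive1 Gamma s) = 1 by apply/enorm1.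
pose kap := geodesic_curvature Gamma.
have cq : continuous (fun s => kap s ^+ 2 / 4) := curvature_continuous dG dT dA G1 T1.
have pq : periodic (fun s => kap s ^+ 2 / 4) ell := curvature_periodic pG dG dT.
have [Q qQ] := periodic_bounded ell0 pq cq.
have [B dB _] := primitive_exists cq.
have [m [u [v [mB du dv pu [x ux]]]]] := hill_periodic_solution ell0 cq pq qQ dB.
have [j lj] : exists j, lam j = - m.
  apply: (eigenfunction_eigenvalue hlam (eigenspace_real pu du dv cq) (s := x)).
  by rewrite eq_complex /= eqxx andbT.
pose W : R := (2 * pi / ell) ^+ 2.
have WB : (W - 1) * ell <= 4 * (B ell - B 0) := total_curvature_ge ell0 pG dG dT dA G1 T1 dB.
(* D is the square of 2 pi times the bound *)
pose D := (W - 1) / 4.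
have pi0 := pi_gt0 R.
have W1 : 1 <= W.
  rewrite -(expr1n _ 2) ler_pXn2r ?nnegrE ?divr_ge0 ?mulr_ge0 ?(ltW pi0) ?(ltW ell0)//.
  by rewrite ler_pdivlMr// mul1r.
have D0 : 0 <= D by rewrite /D; lra.
have Dm : D <= m.
  have : D * ell <= m * ell by rewrite /D; lra.
  by rewrite ler_pM2r.
have bE : Num.sqrt (4 * pi ^+ 2 - ell ^+ 2) / (4 * pi * ell) = (2 * pi)^-1 * Num.sqrt D.
  have -> : 4 * pi ^+ 2 - ell ^+ 2 = (2 * ell) ^+ 2 * D.
    by rewrite /D /W; field; rewrite gt_eqF.
  rewrite sqrtrM ?sqr_ge0// sqrtr_sqr ger0_norm ?mulr_ge0 ?(ltW ell0)//.
  move: pi0; move: (pi : R) => p pi0.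
  by field; rewrite !gt_eqF.
rewrite bE.
have p2 : 0 < (2 * pi : R)^-1 by rewrite invr_gt0 mulr_gt0.
have kSm : 0 < m -> (((2 * pi)^-1 * Num.sqrt m)%:E <= k_S lam)%E.
  by move=> m0; rewrite -[m]opprK -lj k_S_ge// lj oppr_lt0.
split.
  have [m0|m0] := ltP 0 m.
    apply: le_trans (kSm m0); rewrite lee_fin ler_pM2l//.
    exact: ler_wsqrtr.
  have -> : D = 0 by lra.
  by rewrite sqrtr0 mulr0; exact: k_S_ge0.
split=> [eq|cone].
  have mD : m <= D.
    rewrite leNgt; apply/negP => Dlt.
    have m0 : 0 < m by exact: le_lt_trans Dlt.
    have := kSm m0; rewrite eq lee_fin ler_pM2l// leNgt => /negP; apply.
    by rewrite ltr_sqrt.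
  have WBe : (W - 1) * ell = 4 * (B ell - B 0).
    apply/eqP; rewrite eq_le WB /=.
    have : m * ell <= D * ell by rewrite ler_pM2r.
    by rewrite /D; lra.
  have circ := total_curvature_eq ell0 pG dG dT dA dJ cU G1 T1 dB WBe.
  have [w [h [ww hW]]] := curve_is_circle ell0 dG dT G1 T1 circ.
  rewrite rG => Sw.
  have [h0|hn] := eqVneq h 0.
    by exfalso; apply: hplane; apply: (great_circle_plane hS ww); rewrite -h0.
  apply: (small_circle_cone ww hn) => //.
  by rewrite hW gtrBl invr_gt0 -/W; apply: lt_le_trans W1.
have [w [h [r [ww h0 r0 hr Sw]]]] := circular_cone_latitude cone.
have wG s : dot w (Gamma s) = h by apply: Sw; rewrite -rG; exists s.
have [el kr] := latitude_curve ell0 pG dG dT G1 T1 ww r0 hr wG injG.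
have rn : r != 0 by rewrite gt_eqF.
have kk s : kap s ^+ 2 / 4 = (h / r) ^+ 2 / 4 by rewrite -(kr s).
have WE : W = r ^- 2.
  rewrite /W el; move: pi0; move: (pi : R) => p p0.
  by field; rewrite rn gt_eqF.
have DE : (h / r) ^+ 2 / 4 = D.
  by rewrite /D WE expr_div_n (_ : h ^+ 2 = 1 - r ^+ 2); [field|lra].
have [||j0 lj0 neg] := negative_eigenvalues_const ell0 hlam (k := (h / r) ^+ 2 / 4) _ kk.
- by rewrite divr_gt0// exprn_gt0// divr_gt0.
- by rewrite DE -/W /D; lra.
by rewrite (k_S_single neg) lj0 opprK DE.
Qed.
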